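(* A constellation $[\mathbb{X},\mathbb{P}]$ (natural binary code labeling, bit probabilities $P_{C_k}(0)\in(0,1)$) is first-order optimal if and only if both $$\boldsymbol{\mu}=\sum_{i=0}^{M-1}P_i\boldsymbol{x}_i=\boldsymbol{0}$$ and $$\tilde{\boldsymbol{x}}_j=\boldsymbol{0}\quad\text{for all } j\notin\{0\}\cup\{1,2,4,\ldots,M/2\},$$ where $\tilde{\mathbb{X}}$ is the Hadamard transform of $\mathbb{X}$.
   Context: Let $m\ge1$, $M=2^m$, $N\ge1$. For $0\le i\le M-1$, $n_{i,k}\in\{0,1\}$ is the $k$-th bit of $i$ ($i=\sum_kn_{i,k}2^k$). A constellation $[\mathbb{X},\mathbb{P}]$ consists of an alphabet $\mathbb{X}$ with rows $\boldsymbol{x}_0,\ldots,\boldsymbol{x}_{M-1}\in\mathbb{R}^N$, symbol $\boldsymbol{x}_i$ labeled $(n_{i,0},\ldots,n_{i,m-1})$, and distribution $P_i=\prod_kP_{C_k}(n_{i,k})$, $P_{C_k}(1)=1-P_{C_k}(0)$; i.e. independent bits $C_k$ with $\Pr(C_k=u)=P_{C_k}(u)$ select $\boldsymbol{X}=\boldsymbol{x}_i$, $i=\sum_kC_k2^k$. Hadamard transform: $\tilde{\boldsymbol{x}}_i=\frac1M\sum_j\boldsymbol{x}_jh_{i,j}$, $h_{i,j}=\prod_k(-1)^{n_{i,k}n_{j,k}}$. Channel: $\boldsymbol{Y}=\boldsymbol{H}\circ\boldsymbol{X}+\boldsymbol{Z}$, $\boldsymbol{Z}$ zero-mean Gaussian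 with variance $N_0/2$ per dimension, $\boldsymbol{H}$ real fading vector with common marginal pdf $p_H$, known at the receiver (standard regularity conditions assumed). $E_s=\mathbb{E}[\|\boldsymbol{X}\|^2]$, $\mathrm{SNR}=\mathbb{E}[H^2]E_s/N_0$. BICM-GMI: $I(\mathrm{SNR})=\sum_kI(C_k;\boldsymbol{Y}\mid\boldsymbol{H})$ in bits, as a function of SNR; $\alpha=\frac{dI}{d\,\mathrm{SNR}}\big|_{\mathrm{SNR}=0}$. The constellation is first-order optimal (FOO) if $\alpha=\log_2 e$. *)

(* Defs.v *)
From HB Require Import structures.
From mathcomp Require Import all_boot all_order all_algebra.
From mathcomp Require Import all_classical all_reals all_analysis.
Set Implicit Arguments. Unset Strict Implicit. Unset Printing Implicit Defensive.
Import Order.TTheory GRing.Theory Num.Theory.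
Import numFieldNormedType.Exports.
Local Open Scope classical_set_scope.
Local Open Scope ring_scope.

Section Defs.
Variable R : realType.

Definition bit (i k : nat) : bool := odd (i %/ 2 ^ k).

Definition log2 (x : R) : R := ln x / ln 2.

Variables (m N : nat).
Notation M := (2 ^ m)%N.

Definition PC (pC0 : 'I_m -> R) (k : 'I_m) (u : bool) : R :=
  if u then 1 - pC0 k else pC0 k.

Definition Psym (pC0 : 'I_m -> R) (i : 'I_M) : R :=
  \prod_(k < m) PC pC0 k (bit i k).

Definition mean (pC0 : 'I_m -> R) (x : 'I_M -> 'I_N -> R) : 'I_N -> R :=
  fun n => \sum_(i < M) Psym pC0 i * x i n.

Definition Es (pC0 : 'I_m -> R) (x : 'I_M -> 'I_N -> R) : R :=
  \sum_(i < M) Psym pC0 i * \sum_(n < N) x i n ^+ 2.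

Definition hada (i j : nat) : R :=
  \prod_(k < m) (if bit i k && bit j k then -1 else 1).

Definition hadamard (x : 'I_M -> 'I_N -> R) (i : 'I_M) : 'I_N -> R :=
  fun n => M%:R^-1 * \sum_(j < M) x j n * hada i j.

(* Lebesgue integral over R^N, written as the iterated integral
   over the coordinates 0, ..., n-1 *)
Fixpoint iint (n : nat) (g : ('I_N -> R) -> R) : R :=
  match n with
  | 0 => g (fun _ => 0)
  | n'.+1 => Rintegral lebesgue_measure setT
      (fun t => iint n' (fun y => g (fun i => if val i == n' then t else y i)))
  end.
Definition intRN (g : ('I_N -> R) -> R) : R := iint N g.

(* 1-D Gaussian density, zero mean, variance N0/2 *)
Definition gauss (N0 t : R) : R := expR (- (t ^+ 2) / N0) / Num.sqrt (pi * N0).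

Definition pYgX (N0 : R) (x : 'I_M -> 'I_N -> R) (h : 'I_N -> R) (i : 'I_M)
  (y : 'I_N -> R) : R := \prod_(n < N) gauss N0 (y n - h n * x i n).

Definition pY pC0 N0 x h y : R := \sum_(i < M) Psym pC0 i * pYgX N0 x h i y.

Definition pYgC pC0 N0 x h (k : 'I_m) (u : bool) y : R :=
  (\sum_(i < M | bit i k == u) Psym pC0 i * pYgX N0 x h i y) / PC pC0 k u.

Definition MIk pC0 N0 x h (k : 'I_m) : R :=
  \sum_(u : bool) PC pC0 k u *
    intRN (fun y => pYgC pC0 N0 x h k u y *
                    log2 (pYgC pC0 N0 x h k u y / pY pC0 N0 x h y)).

(* E[H^2] from the common marginal pdf *)
Definition EH2 (pH : R -> R) : R :=
  Rintegral lebesgue_measure setT (fun t => t ^+ 2 * pH t).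

(* BICM-GMI as a function of SNR = E[H^2] E_s / N0 (for SNR > 0):
   I(SNR) = sum_k I(C_k; Y | H), fading vector H on a probability space *)
Definition GMI d (T : measurableType d) (P : probability T R)
  (H : 'I_N -> T -> R) (pH : R -> R) pC0 x (snr : R) : R :=
  let N0 := EH2 pH * Es pC0 x / snr in
  \sum_(k < m) Rintegral P setT (fun w => MIk pC0 N0 x (fun n => H n w) k).

(* first-order optimality: alpha = dI/dSNR at SNR = 0 equals log2 e,
   with I(0) = 0, i.e. I(SNR)/SNR -> log2 e as SNR -> 0+ *)
Definition FOO d (T : measurableType d) (P : probability T R)
  (H : 'I_N -> T -> R) (pH : R -> R) pC0 x : Prop :=
  (fun s => GMI P H pH pC0 x s / s) @ 0^'+ --> log2 (expR 1).

End Defs.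

(* Main.v *)
Require Import Defs.
From HB Require Import structures.
From mathcomp Require Import all_boot all_order all_algebra.
From mathcomp Require Import all_classical all_reals all_analysis.
From mathcomp Require Import measurable_realfun.
From mathcomp Require Import ring lra.
Import Order.TTheory GRing.Theory Num.Theory.
Import numFieldNormedType.Exports.
Local Open Scope classical_set_scope.
Local Open Scope ring_scope.
Set Implicit Arguments.
Unset Strict Implicit.
Unset Printing Implicit Defensive.

(** Let [phi] be the density of the noise and [L_i] the likelihood ratio of the
symbol [i] against [phi].  For weights [v] put [L_v = sum_i v_i L_i] and
[h(v) = E_phi (L_v ln L_v)].  Then [ln 2 * I(C_k; Y | H = h)] is
[sum_u P(C_k = u) h(P(. | C_k = u)) - h(P)], so it suffices to expand [h(v)] at low
SNR.  Since [t ln t = (t - 1) + (t - 1)^2 / 2 + O(|t - 1|^3)] and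
[E_phi (L_i L_j) = exp (2 <a_i, a_j> / N0)] with [a_i = h o x_i], one finds
[N0 h(v) -> |sum_i v_i a_i|^2], and [0 <= h(v) <= C sum_i v_i |a_i|^2 / N0] allows
dominated convergence over the fading, using only [E H^2 < oo].  Hence
[alpha = log2 e * sum_k Var (E (X | C_k)) / Es].

The centred bits are orthogonal, so Bessel's identity says that
[Es - sum_k Var (E (X | C_k))] is [|mu|^2] plus the mean squared distance of [X] to its
projection onto the affine functions of the bits.  It vanishes iff [mu = 0] and [X] is
affine in the bits, and the latter means that the Hadamard coefficients outside
[0, 1, 2, 4, ..., M/2] vanish. *)

(** * Iterated integrals of dominated functions *)

Section IteratedIntegral.
Context {R : realType} {N : nat}.
Notation E := ('I_N -> R).
Notation lam := (@lebesgue_measure R).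

Definition upd (y : E) (n : nat) (t : R) : E :=
  fun i => if val i == n then t else y i.

(* ['I_N -> R] carries no sigma-algebra, so measurability is tested by composing with
   families that are measurable in each coordinate. *)
Definition pmeas {d} {U : measurableType d} (G : U -> E -> R) : Prop :=
  forall d' (V : measurableType d') (a : V -> U) (Y : V -> E),
    measurable_fun setT a -> (forall i, measurable_fun setT (fun v => Y v i)) ->
    measurable_fun setT (fun v => G (a v) (Y v)).

Definition emeas (g : E -> R) : Prop :=
  forall d' (V : measurableType d') (Y : V -> E),
    (forall i, measurable_fun setT (fun v => Y v i)) ->
    measurable_fun setT (fun v => g (Y v)).

(** The integral splits into those of the positive and negative parts. Tonelli makes each measurable
    in the parameter, and [fine] is measurable. *)
Lemma measurable_Rintegral_param {d} {U : measurableType d} (f : U * R -> R) :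
  measurable_fun setT f ->
  measurable_fun setT (fun u => Rintegral lam setT (fun t => f (u, t))).
Proof.
move=> mf.
have mf' : measurable_fun setT (fun p => (f p)%:E) by exact/measurable_EFinP.
apply: (measurableT_comp (fine_measurable measurableT)).
under eq_fun do rewrite integralE.
apply: emeasurable_funB.
- apply: eq_measurable_fun (measurable_fun_fubini_tonelli_F (m2 := lam) _
    (measurable_funepos mf') (funepos_ge0 _)) => u _.
  by apply: eq_integral => t _; rewrite !funeposE.
- apply: eq_measurable_fun (measurable_fun_fubini_tonelli_F (m2 := lam) _
    (measurable_funeneg mf') (funeneg_ge0 _)) => u _.
  by apply: eq_integral => t _; rewrite !funenegE.
Qed.

(** Induction on [n] with the parameter space quantified inside: the coordinate being integrated
    joins the parameter, which then ranges over [U * R]. *)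
Lemma measurable_iint n : forall d (U : measurableType d) (G : U -> E -> R),
  pmeas G -> measurable_fun setT (fun u => iint n (G u)).
Proof.
elim: n => [|n IH] d U G mG /=; first by apply: mG.
apply: (measurable_Rintegral_param (f :=
  fun p : U * R => iint n (fun y => G p.1 (upd y n p.2)))).
apply: (IH _ _ (fun (p : U * R) y => G p.1 (upd y n p.2))) => d' V a Y ma mY.
apply: (mG _ _ (fun v => (a v).1) (fun v => upd (Y v) n (a v).2)).
  exact: measurableT_comp.
move=> i; rewrite /upd; case: (val i == n); last exact: mY.
exact: measurableT_comp.
Qed.


Lemma emeas_slice g n : emeas g -> pmeas (fun t y => g (upd y n t)).
Proof.
move=> mg d' V a Y ma mY; apply: (mg _ _ (fun v => upd (Y v) n (a v))) => i.
by rewrite /upd; case: (val i == n); [exact: ma | exact: mY].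
Qed.

Lemma emeas_upd g n t : emeas g -> emeas (fun y => g (upd y n t)).
Proof.
move=> mg d' V Y mY.
by have := emeas_slice n mg (a := fun=> t) _ mY; apply.
Qed.

Lemma prod_upd n (hn : (n < N)%N) (F : 'I_N -> R -> R) y t :
  \prod_(i < N | (i < n.+1)%N) F i (upd y n t i) =
  F (Ordinal hn) t * \prod_(i < N | (i < n)%N) F i (y i).
Proof.
rewrite (bigD1 (Ordinal hn)) //= {1}/upd /= eqxx; congr (_ * _).
apply: eq_big => [i|i /andP[_ ni]]; last first.
  by rewrite /upd; case: eqP => // e; case/eqP: ni; exact: val_inj.
by rewrite -(inj_eq val_inj) /= ltnS andbC ltn_neqAle.
Qed.

(** The bound is uniform in the coordinates from [n] on, and [C] stays free because fixing
    coordinate [n] at [t] turns it into [C * w t]. *)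
Definition dominated_by n (w : R -> R) (C : R) (g : E -> R) :=
  forall y, `|g y| <= C * \prod_(i < N | (i < n)%N) w (y i).

Lemma dominated_by_upd n w C g t : (n < N)%N ->
  dominated_by n.+1 w C g -> dominated_by n w (C * w t) (fun y => g (upd y n t)).
Proof.
move=> hn dg y; apply: le_trans (dg _) _.
by rewrite (prod_upd hn (fun=> w)) mulrA.
Qed.

Section Dominated.
Variables (w : R -> R).
Hypothesis w_int : lam.-integrable setT (EFin \o w).
Notation Iw := (Rintegral lam setT w).

(** The bound on the slices is a hypothesis here, so that the result can be used inside the
    induction that proves [iint_bound]. *)
Let integrable_slice_aux n g C : (n < N)%N -> emeas g ->
  (forall t, `|iint n (fun y => g (upd y n t))| <= C * w t * Iw ^+ n) ->
  lam.-integrable setT (EFin \o (fun t => iint n (fun y => g (upd y n t)))).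
Proof.
move=> hn mg bd.
have wi : lam.-integrable setT (EFin \o (fun t => (C * Iw ^+ n) * w t)).
  rewrite (_ : _ \o _ = (fun t => (C * Iw ^+ n)%:E * (w t)%:E)%E); last first.
    by apply/funext => t /=; rewrite EFinM.
  exact: integrableZl.
apply: le_integrable wi => //.
  apply/measurable_EFinP/measurable_iint; exact: emeas_slice.
move=> t _ /=; rewrite lee_fin; apply: le_trans (bd t) _.
by rewrite mulrAC; exact: ler_norm.
Qed.

Lemma iint_bound n : forall g C, (n <= N)%N -> emeas g -> dominated_by n w C g ->
  `|iint n g| <= C * Iw ^+ n.
Proof.
elim: n => [|n IH] g C hn mg dg /=.
  by have := dg (fun=> 0); rewrite big_pred0 // => i; rewrite ltn0.
have bd t : `|iint n (fun y => g (upd y n t))| <= C * w t * Iw ^+ n.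
  by apply: IH; [exact: ltnW | exact: emeas_upd | exact: dominated_by_upd].
have ig := integrable_slice_aux hn mg bd.
apply: le_trans (le_normr_Rintegral measurableT ig) _.
rewrite exprSr mulrA -RintegralZl //; apply: le_Rintegral => //.
- exact: (integrable_norm ig).
- rewrite (_ : _ \o _ = (fun t => (C * Iw ^+ n)%:E * (w t)%:E)%E); last first.
    by apply/funext => t /=; rewrite EFinM.
  exact: integrableZl.
- by move=> t _; rewrite mulrAC; exact: bd.
Qed.

Lemma integrable_slice n g C : (n < N)%N -> emeas g -> dominated_by n.+1 w C g ->
  lam.-integrable setT (EFin \o (fun t => iint n (fun y => g (upd y n t)))).
Proof.
move=> hn mg dg; apply: (@integrable_slice_aux _ _ C) => // t.
by apply: iint_bound; [exact: ltnW | exact: emeas_upd | exact: dominated_by_upd].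
Qed.

Lemma iintD n : forall f g C C', (n <= N)%N -> emeas f -> emeas g ->
  dominated_by n w C f -> dominated_by n w C' g ->
  iint n (fun y => f y + g y) = iint n f + iint n g.
Proof.
elim: n => [//|n IH] f g C C' hn mf mg df dg /=.
rewrite -RintegralD //; last 2 first.
- exact: integrable_slice df.
- exact: integrable_slice dg.
apply: eq_Rintegral => t _.
apply: (IH _ _ (C * w t) (C' * w t) (ltnW hn)); try exact: emeas_upd; exact: dominated_by_upd.
Qed.

Lemma iintZ n : forall f a C, (n <= N)%N -> emeas f -> dominated_by n w C f ->
  iint n (fun y => a * f y) = a * iint n f.
Proof.
elim: n => [//|n IH] f a C hn mf df /=.
rewrite -RintegralZl //; last exact: integrable_slice df.
apply: eq_Rintegral => t _.
by apply: (IH _ _ (C * w t) (ltnW hn)); [exact: emeas_upd | exact: dominated_by_upd].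
Qed.

Lemma le_iint n : forall f g C C', (n <= N)%N -> emeas f -> emeas g ->
  dominated_by n w C f -> dominated_by n w C' g -> (forall y, f y <= g y) ->
  iint n f <= iint n g.
Proof.
elim: n => [|n IH] f g C C' hn mf mg df dg fg /=; first exact: fg.
apply: (le_Rintegral measurableT (integrable_slice hn mf df)
  (integrable_slice hn mg dg)) => t _.
apply: (IH _ _ (C * w t) (C' * w t) (ltnW hn)) => //; try exact: emeas_upd; exact: dominated_by_upd.
Qed.

End Dominated.

(** The constant [c] is general because in the induction it absorbs the factor of the outermost
    coordinate. *)
Lemma iint_prod n : forall (F : 'I_N -> R -> R) c, (n <= N)%N ->
  (forall i, lam.-integrable setT (EFin \o F i)) ->
  iint n (fun y => c * \prod_(i < N | (i < n)%N) F i (y i)) =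
  c * \prod_(i < N | (i < n)%N) Rintegral lam setT (F i).
Proof.
elim: n => [|n IH] F c hn iF /=; first by rewrite !big_pred0.
rewrite [in RHS](bigD1 (Ordinal hn)) //=.
have -> : \prod_(i < N | (i < n.+1)%N && (i != Ordinal hn)) Rintegral lam setT (F i) =
          \prod_(i < N | (i < n)%N) Rintegral lam setT (F i).
  by apply: eq_bigl => i; rewrite -(inj_eq val_inj) /= ltnS andbC ltn_neqAle.
rewrite mulrCA -RintegralZr //.
apply: eq_Rintegral => t _.
rewrite mulrCA mulrA -IH //; last exact: ltnW.
congr iint; apply/funext => y.
by rewrite -mulrA -(prod_upd hn).
Qed.

End IteratedIntegral.

(** * Linearity and monotonicity of the integral on dominated functions *)

Section Good.
Context {R : realType} {N : nat}.
Notation E := ('I_N -> R).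
Notation lam := (@lebesgue_measure R).

Definition good (g : E -> R) : Prop := emeas g /\
  exists (w : R -> R) (C : R), [/\ forall t, 0 <= w t, lam.-integrable setT (EFin \o w), 0 <= C &
    forall y, `|g y| <= C * \prod_(i < N) w (y i)].

Lemma dominated_by_full (w : R -> R) (C : R) (g : E -> R) :
  (forall y, `|g y| <= C * \prod_(i < N) w (y i)) -> dominated_by N w C g.
Proof.
move=> h y; rewrite (eq_bigl xpredT) // => i; exact: ltn_ord.
Qed.

(** Both weights are nonnegative, so their sum dominates each of them and serves for both
    functions. *)
Lemma good_common f g : good f -> good g -> exists (w : R -> R) (C C' : R),
  [/\ (forall t, 0 <= w t) /\ lam.-integrable setT (EFin \o w), 0 <= C, 0 <= C',
    (forall y, `|f y| <= C * \prod_(i < N) w (y i)) &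
    (forall y, `|g y| <= C' * \prod_(i < N) w (y i))].
Proof.
move=> [_ [w [C [w0 iw C0 fw]]]] [_ [w' [C' [w0' iw' C0' gw]]]].
exists (fun t => w t + w' t), C, C'; split => //.
- split; first by move=> t; rewrite addr_ge0.
  rewrite (_ : _ \o _ = (fun t => (w t)%:E + (w' t)%:E)%E) //.
  exact: integrableD.
- move=> y; apply: le_trans (fw y) _; apply: ler_wpM2l => //.
  by apply: ler_prod => i _; rewrite w0 lerDl w0'.
- move=> y; apply: le_trans (gw y) _; apply: ler_wpM2l => //.
  by apply: ler_prod => i _; rewrite w0' lerDr w0.
Qed.

Lemma emeasD f g : emeas f -> emeas g -> emeas (fun y : E => f y + g y).
Proof. by move=> mf mg d V Y mY; apply: measurable_funD; [exact: mf|exact: mg]. Qed.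

Lemma emeasM f g : emeas f -> emeas g -> emeas (fun y : E => f y * g y).
Proof. by move=> mf mg d V Y mY; apply: measurable_funM; [exact: mf|exact: mg]. Qed.

Lemma emeasZ a f : emeas f -> emeas (fun y : E => a * f y).
Proof. by move=> mf d V Y mY; apply: measurable_funM => //; exact: mf. Qed.

Lemma goodD f g : good f -> good g -> good (fun y => f y + g y).
Proof.
move=> gf gg; split; first by apply: emeasD; [case: gf | case: gg].
have [w [C [C' [[w0 iw] C0 C0' fw gw]]]] := good_common gf gg.
exists w, (C + C'); split => //; first by rewrite addr_ge0.
move=> y; apply: le_trans (ler_normD _ _) _.
by rewrite mulrDl lerD.
Qed.

Lemma goodZ a f : good f -> good (fun y => a * f y).
Proof.
move=> [mf [w [C [w0 iw C0 fw]]]]; split; first exact: emeasZ.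
exists w, (`|a| * C); split => //; first by rewrite mulr_ge0.
by move=> y; rewrite normrM -mulrA ler_wpM2l.
Qed.

Lemma good_le f g : emeas f -> (forall y, `|f y| <= g y) -> good g -> good f.
Proof.
move=> mf fg [_ [w [C [w0 iw C0 gw]]]]; split=> //; exists w, C; split => // y.
by apply: le_trans (fg y) _; apply: le_trans (gw y); exact: ler_norm.
Qed.

Lemma intRND f g : good f -> good g ->
  intRN (fun y => f y + g y) = intRN f + intRN g.
Proof.
move=> gf gg; have [w [C [C' [[w0 iw] C0 C0' fw gw]]]] := good_common gf gg.
exact: (iintD iw (leqnn N) gf.1 gg.1 (dominated_by_full fw)
  (dominated_by_full gw)).
Qed.

Lemma intRNZ a f : good f -> intRN (fun y => a * f y) = a * intRN f.
Proof.
move=> [mf [w [C [w0 iw C0 fw]]]].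
exact: (iintZ iw a (leqnn N) mf (dominated_by_full fw)).
Qed.

Lemma le_intRN f g : good f -> good g -> (forall y, f y <= g y) ->
  intRN f <= intRN g.
Proof.
move=> gf gg; have [w [C [C' [[w0 iw] C0 C0' fw gw]]]] := good_common gf gg.
exact: (le_iint iw (leqnn N) gf.1 gg.1 (dominated_by_full fw)
  (dominated_by_full gw)).
Qed.

(** The function [g0] handles the empty sum, which is written as [0 * g0]. *)
Lemma good_intRN_sum (I : Type) (r : seq I) (f : I -> E -> R) (g0 : E -> R) :
  good g0 -> (forall i, good (f i)) ->
  good (fun y => \sum_(i <- r) f i y) /\
  intRN (fun y => \sum_(i <- r) f i y) = \sum_(i <- r) intRN (f i).
Proof.
move=> gg0 gf; elim: r => [|i r [IH1 IH2]].
  have -> : (fun y => \sum_(i <- [::]) f i y) = (fun y => 0 * g0 y).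
    by apply/funext => y; rewrite big_nil mul0r.
  by split; [exact: goodZ | rewrite intRNZ // mul0r big_nil].
have -> : (fun y => \sum_(j <- i :: r) f j y) =
          (fun y => f i y + \sum_(j <- r) f j y).
  by apply/funext => y; rewrite big_cons.
by split; [exact: goodD | rewrite intRND // IH2 big_cons].
Qed.

End Good.

(** * Exponential moments of the Gaussian density *)

Section Gauss.
Context {R : realType} {N : nat} (N0 : R).
Hypothesis N0_gt0 : 0 < N0.
Notation E := ('I_N -> R).
Notation lam := (@lebesgue_measure R).

Definition phi (y : E) : R := \prod_(n < N) gauss N0 (y n).

Definition dotp (a b : E) : R := \sum_(n < N) a n * b n.

Lemma gauss_normal_pdf (b t : R) :
  gauss N0 (t - b) = normal_pdf b (Num.sqrt (N0 / 2)) t.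
Proof.
have N2 : 0 < N0 / 2 by rewrite divr_gt0.
rewrite normal_pdfE; last by rewrite gt_eqF // sqrtr_gt0.
rewrite /gauss /normal_peak /normal_fun sqr_sqrtr ?ltW //.
rewrite (_ : N0 / 2 * pi *+ 2 = pi * N0); last by rewrite -mulr_natr; field.
rewrite (_ : N0 / 2 *+ 2 = N0); last by rewrite -mulr_natr; field.
by rewrite mulrC.
Qed.

Lemma gauss_gt0 (t : R) : 0 < gauss N0 t.
Proof. by rewrite /gauss divr_gt0 ?expR_gt0 // sqrtr_gt0 mulr_gt0 ?pi_gt0. Qed.

Lemma gauss_shift (a t : R) :
  gauss N0 (t - a) = gauss N0 t * expR ((2 * (t * a) - a ^+ 2) / N0).
Proof.
rewrite /gauss mulrAC -expRD; congr (expR _ / _); field.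
by rewrite gt_eqF.
Qed.

Let tilt1 (b t : R) := gauss N0 t * expR (2 / N0 * (t * b)).

(** Completing the square: an exponential tilt of a Gaussian is a shifted Gaussian up to a constant,
    so its integral can be read off. *)
Let tilt1E b t : tilt1 b t = expR (b ^+ 2 / N0) * gauss N0 (t - b).
Proof.
rewrite gauss_shift mulrCA -expRD; congr (_ * expR _); field.
by rewrite gt_eqF.
Qed.

Let tilt1_int b : lam.-integrable setT (EFin \o tilt1 b) /\
  Rintegral lam setT (tilt1 b) = expR (b ^+ 2 / N0).
Proof.
have ig : lam.-integrable setT (EFin \o (fun t => gauss N0 (t - b))).
  rewrite (_ : _ \o _ = (fun t => (normal_pdf b (Num.sqrt (N0 / 2)) t)%:E)).
    exact: integrable_normal_pdf.
  by apply/funext => t /=; rewrite gauss_normal_pdf.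
split.
  rewrite (_ : _ \o _ = (fun t => (expR (b ^+ 2 / N0))%:E * (gauss N0 (t - b))%:E)%E).
    exact: integrableZl.
  by apply/funext => t /=; rewrite tilt1E EFinM.
rewrite (_ : tilt1 b = (fun t => expR (b ^+ 2 / N0) * gauss N0 (t - b))); last first.
  by apply/funext => t; rewrite tilt1E.
rewrite RintegralZl // /Rintegral.
under eq_integral do rewrite gauss_normal_pdf.
by rewrite integral_normal_pdf mulr1.
Qed.

Let tilt1_ge0 b t : 0 <= tilt1 b t.
Proof. by rewrite mulr_ge0 ?expR_ge0 // ltW // gauss_gt0. Qed.

Lemma measurable_gauss (M : R) : measurable_fun setT (gauss M).
Proof.
apply: measurable_funM => //; apply: measurableT_comp => //.
apply: measurable_funM => //; exact: measurableT_comp.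
Qed.

Lemma emeas_phi : emeas phi.
Proof.
move=> d V Y mY; apply: measurable_prod => i _.
by apply: measurableT_comp => //; exact: measurable_gauss.
Qed.

Lemma emeas_dotp b : emeas (fun y : E => dotp y b).
Proof.
by move=> d V Y mY; apply: measurable_sum => i; exact: measurable_funM.
Qed.

Let kern_prod b (y : E) : phi y * expR (2 / N0 * dotp y b) =
  \prod_(n < N) tilt1 (b n) (y n).
Proof. by rewrite /dotp mulr_sumr expR_sum big_split. Qed.

Let good_kern b : good (fun y : E => phi y * expR (2 / N0 * dotp y b)).
Proof.
split.
  apply: emeasM; first exact: emeas_phi.
  move=> d V Y mY; apply: measurableT_comp => //.
  by apply: measurable_funM => //; exact: emeas_dotp.
(* The factors differ from one coordinate to another but [good] asks for a single weight; their sum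
   dominates each of them. *)
exists (fun t => \sum_(n < N) tilt1 (b n) t), 1; split => //.
- by move=> t; apply: sumr_ge0 => n _; exact: tilt1_ge0.
- rewrite (_ : _ \o _ = (fun t => \sum_(n < N) (tilt1 (b n) t)%:E)%E); last first.
    by apply/funext => t /=; rewrite sumEFin.
  by apply: integrable_sum => // n _; have [] := tilt1_int (b n).
move=> y; rewrite kern_prod mul1r ger0_norm; last first.
  by apply: prodr_ge0 => n _; exact: tilt1_ge0.
apply: ler_prod => n _; rewrite tilt1_ge0 /= (bigD1 n) //= lerDl.
by apply: sumr_ge0 => i _; exact: tilt1_ge0.
Qed.

Let intRN_kern b : intRN (fun y : E => phi y * expR (2 / N0 * dotp y b)) =
  expR (dotp b b / N0).
Proof.
have := iint_prod (n := N) (F := fun n => tilt1 (b n)) 1 (leqnn N)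
  (fun i => (tilt1_int (b i)).1).
rewrite /intRN (_ : (fun y => _) = (fun y => phi y * expR (2 / N0 * dotp y b))).
  move=> ->; rewrite mul1r /dotp mulr_suml expR_sum.
  by apply: eq_big => [i|i _]; rewrite ?ltn_ord // (tilt1_int (b i)).2 -expr2.
apply/funext => y; rewrite mul1r kern_prod.
by apply: eq_bigl => i; rewrite ltn_ord.
Qed.

Lemma good_tilt b c : good (fun y : E => phi y * expR (2 / N0 * dotp y b + c)).
Proof.
rewrite (_ : (fun y => _) =
  (fun y => expR c * (phi y * expR (2 / N0 * dotp y b)))); first exact: goodZ.
by apply/funext => y; rewrite expRD; ring.
Qed.

Lemma intRN_tilt b c : intRN (fun y : E => phi y * expR (2 / N0 * dotp y b + c)) =
  expR (dotp b b / N0 + c).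
Proof.
rewrite (_ : (fun y => _) =
  (fun y => expR c * (phi y * expR (2 / N0 * dotp y b)))).
  by rewrite intRNZ // intRN_kern -expRD addrC.
by apply/funext => y; rewrite expRD; ring.
Qed.

End Gauss.

(** * Elementary inequalities for [t ln t] *)

Section Scalar.
Context {R : realType}.
Implicit Types t e l z : R.

Definition xlnx t := t * ln t.

Lemma ln_le_subr1 t : 0 < t -> ln t <= t - 1.
Proof.
move=> t0; have := @le_ln1Dx R (t - 1); rewrite addrCA subrr addr0; apply.
by lra.
Qed.

Lemma ln_ge_1Vr t : 0 < t -> 1 - t^-1 <= ln t.
Proof.
move=> t0; have := @ln_le_subr1 t^-1; rewrite invr_gt0 lnV // => /(_ t0); lra.
Qed.

Lemma xlnx_ge t : 0 < t -> t - 1 <= xlnx t.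
Proof.
move=> t0; have := ln_ge_1Vr t0; rewrite -(ler_pM2l t0) mulrBr mulr1 divff //.
by rewrite gt_eqF.
Qed.

Lemma xlnx_le t : 0 < t -> xlnx t <= t * (t - 1).
Proof. by move=> t0; rewrite ler_pM2l // ln_le_subr1. Qed.

Lemma xlnx_norm_le t : 0 < t -> `|xlnx t| <= 1 + t ^+ 2.
Proof.
move=> t0; have := xlnx_ge t0; have := xlnx_le t0; rewrite ler_norml => h1 h2.
have := sqr_ge0 t; rewrite expr2 in h1 *; lra.
Qed.

(** The left side is the tangent line of [xlnx] at [s], so this is convexity in the form that
    Jensen's inequality uses. *)
Lemma xlnx_tangent s t : 0 < s -> 0 < t -> t * ln s + (t - s) <= xlnx t.
Proof.
move=> s0 t0; have := @ln_ge_1Vr (t / s) (divr_gt0 t0 s0).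
rewrite ln_div // -(ler_pM2l t0) /xlnx invf_div mulrBr mulr1 mulrCA divff ?gt_eqF //.
lra.
Qed.

Lemma is_derive_xlnx_taylor t : 0 < t ->
  is_derive t (1 : R) (fun t => t * ln t - (t - 1) - (t - 1) ^+ 2 / 2) (ln t - (t - 1)).
Proof.
move=> t0; have dl := is_derive1_ln t0.
apply: is_derive_eq.
rewrite /GRing.scale /= ; field.
by rewrite gt_eqF.
Qed.

(** For [t < 1/2] the right side is at least 1 and crude bounds suffice. Otherwise the mean value
    theorem applies: the derivative [ln c - (c - 1)] lies between [- (c - 1)^2 / c] and 0, and
    [1 / c <= 2]. *)
Lemma xlnx_taylor3 t : 0 < t ->
  `|xlnx t - (t - 1) - (t - 1) ^+ 2 / 2| <= 8 * `|t - 1| ^+ 3.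
Proof.
move=> t0.
have [t2|t2] := ltP t (1 / 2).
  have h1 := xlnx_ge t0; have h2 := xlnx_le t0.
  have -> : `|t - 1| = 1 - t by rewrite ltr0_norm; lra.
  apply: (@le_trans _ _ 1); rewrite ?ler_norml; first by nra.
  have : (1 / 2) ^+ 3 <= (1 - t) ^+ 3 by rewrite lerXn2r ?nnegrE; lra.
  lra.
pose g t := t * ln t - (t - 1) - (t - 1) ^+ 2 / 2.
have g1 : g 1 = 0 by rewrite /g ln1 subrr expr0n /=; lra.
have bd c : 1 / 2 <= c -> `|c - 1| <= `|t - 1| ->
   `|(ln c - (c - 1)) * (t - 1)| <= 8 * `|t - 1| ^+ 3.
  move=> c2 ct; have c0 : 0 < c by lra.
  have := ln_ge_1Vr c0; have := ln_le_subr1 c0 => u1 u2.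
  have ci : c^-1 <= 2 by rewrite -[2]invrK lef_pV2 ?posrE //; lra.
  have ci0 : 0 < c^-1 by rewrite invr_gt0.
  have e1 : (c - 1) ^+ 2 * c^-1 = (c - 1) - (1 - c^-1) by field; rewrite gt_eqF.
  rewrite normrM.
  have h : `|ln c - (c - 1)| <= 2 * (c - 1) ^+ 2.
    have := sqr_ge0 (c - 1); rewrite ler_norml; nra.
  have h3 : (c - 1) ^+ 2 <= `|t - 1| ^+ 2.
    by rewrite -(real_normK (num_real (c - 1))) lerXn2r ?nnegrE.
  rewrite (exprSr _ 2) mulrA; apply: ler_wpM2r => //.
  have := sqr_ge0 `|t - 1|; lra.
have cont (a b : R) : 0 < a -> {within `[a, b], continuous g}.
  move=> a0; apply: derivable_within_continuous => c; rewrite in_itv /= => /andP[ac _].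
  have c0 : 0 < c by exact: lt_le_trans ac.
  by have [] := is_derive_xlnx_taylor c0.
have der (a b c : R) : 0 < a -> c \in `]a, b[%R -> is_derive c (1 : R) g (ln c - (c - 1)).
  move=> a0; rewrite in_itv /= => /andP[ac _].
  by apply: is_derive_xlnx_taylor; exact: lt_trans ac.
have -> : xlnx t - (t - 1) - (t - 1) ^+ 2 / 2 = g t - g 1 by rewrite g1 subr0.
have [t1|t1|->] := ltgtP t 1; last by rewrite !subrr normr0 expr0n mulr0.
  have [c cin E] := MVT t1 (fun c => @der t 1 c t0) (cont t 1 t0).
  rewrite distrC E; move: cin; rewrite in_itv /= => /andP[ct c1].
  have -> : (ln c - (c - 1)) * (1 - t) = - ((ln c - (c - 1)) * (t - 1)) by ring.
  rewrite normrN; apply: bd; first by lra.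
  by rewrite !ltr0_norm; lra.
have [c cin E] := MVT t1 (fun c => @der 1 t c ltr01) (cont 1 t ltr01).
rewrite E; move: cin; rewrite in_itv /= => /andP[c1 ct].
apply: bd; first by lra.
by rewrite !gtr0_norm; lra.
Qed.

(** The cubic error is traded for even powers, whose Gaussian expectations are explicit sums of
    exponentials. With [a = |t - 1|], the two bounds differ by [a^2 (e - 4 a)^2 / e]. *)
Lemma xlnx_taylor e t : 0 < e -> 0 < t ->
  `|xlnx t - (t - 1) - (t - 1) ^+ 2 / 2| <=
  e * (t - 1) ^+ 2 + 16 / e * (t - 1) ^+ 4.
Proof.
move=> e0 t0; apply: le_trans (xlnx_taylor3 t0) _.
rewrite -(real_normK (num_real (t - 1))).
have -> : (t - 1) ^+ 4 = `|t - 1| ^+ 4.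
  by rewrite (exprM _ 2 2) (exprM `|_| 2 2) real_normK // num_real.
set a := `|t - 1|; rewrite -subr_ge0.
have -> : e * a ^+ 2 + 16 / e * a ^+ 4 - 8 * a ^+ 3 = a ^+ 2 * ((e - 4 * a) ^+ 2 / e).
  by field; rewrite gt_eqF.
by rewrite mulr_ge0 ?divr_ge0 ?sqr_ge0 // ltW.
Qed.

(** This is [1 + e l <= exp (e l)] multiplied by [exp l / e]. For [l] a log-likelihood ratio it
    bounds [L ln L] by powers of [L], whose expectations are known. *)
Lemma mul_expR_le e l : 0 < e -> expR l * l <= e^-1 * (expR ((1 + e) * l) - expR l).
Proof.
move=> e0; rewrite mulrDl mul1r expRD -{3}[expR l]mulr1 -mulrBr mulrCA.
rewrite ler_pM2l ?expR_gt0 // ler_pdivlMl // lerBrDl.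
exact: expR_ge1Dx.
Qed.

(* The best [e] depends on [z]: take [e = 1] if [z <= 1] and [e = 1 / z] otherwise. *)
Lemma expR_div_bound (A z : R) : 0 <= z ->
  (forall e, 0 < e -> A <= e^-1 * (expR (e * (1 + e) * z) - 1)) ->
  A <= 2 * expR 2 * z.
Proof.
move=> z0 hA.
have h (x : R) : expR x - 1 <= x * expR x.
  have := expR_ge1Dx (- x); rewrite -(ler_pM2r (expR_gt0 x)) -expRD addNr expR0; lra.
have [z1|z1] := leP z 1.
  have := hA 1 ltr01; rewrite invr1 mul1r (_ : 1 * (1 + 1) * z = 2 * z); last by ring.
  have := h (2 * z).
  have : expR (2 * z) <= expR 2 by rewrite ler_expR; lra.
  move=> h1 h2 h3; apply: le_trans h3 _; apply: le_trans h2 _.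
  by rewrite [leRHS]mulrAC; apply: ler_wpM2l => //; rewrite mulr_ge0.
have zp : 0 < z by lra.
apply: le_trans (hA z^-1 _) _; first by rewrite invr_gt0.
rewrite invrK (_ : z^-1 * (1 + z^-1) * z = 1 + z^-1); last by field; rewrite gt_eqF.
have : expR (1 + z^-1) <= expR 2.
  have : z^-1 <= 1 by rewrite invf_le1 // ltW.
  by rewrite ler_expR; lra.
move=> h1; rewrite [leRHS]mulrC; apply: ler_wpM2l => //.
have := expR_gt0 (2 : R); lra.
Qed.

End Scalar.

(** * Jensen's inequality for finite convex combinations *)

Section Jensen.
Context {R : realType} {I : finType} (v : I -> R).
Hypothesis v_ge0 : forall i, 0 <= v i.
Hypothesis v_sum1 : \sum_i v i = 1.

Lemma convex_comb_gt0 (t : I -> R) : (forall i, 0 < t i) -> 0 < \sum_i v i * t i.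
Proof.
move=> t0; rewrite lt_def sumr_ge0 ?andbT; last by move=> i _; rewrite mulr_ge0 // ltW.
apply/eqP => /psumr_eq0P h; have := oner_eq0 R; rewrite -v_sum1 big1 ?eqxx // => i _.
have /eqP := h (fun i _ => mulr_ge0 (v_ge0 i) (ltW (t0 i))) i isT.
by rewrite mulf_eq0 (gt_eqF (t0 i)) orbF => /eqP.
Qed.

Lemma xlnx_jensen (t : I -> R) : (forall i, 0 < t i) ->
  xlnx (\sum_i v i * t i) <= \sum_i v i * xlnx (t i).
Proof.
move=> t0; set s := \sum_i v i * t i; have s0 : 0 < s by exact: convex_comb_gt0.
apply: (@le_trans _ _ (\sum_i v i * (t i * ln s + (t i - s)))); last first.
  by apply: ler_sum => i _; rewrite ler_wpM2l // xlnx_tangent.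
rewrite le_eqVlt; apply/orP; left; apply/eqP.
under eq_bigr do rewrite mulrDr mulrBr mulrA.
by rewrite big_split /= sumrB -!mulr_suml -/s v_sum1 mul1r subrr addr0.
Qed.

(** The difference of the two sides is the variance of [t] under [v]. *)
Lemma sqr_jensen (t : I -> R) : (\sum_i v i * t i) ^+ 2 <= \sum_i v i * t i ^+ 2.
Proof.
set s := \sum_i v i * t i; rewrite -subr_ge0.
have -> : \sum_i v i * t i ^+ 2 - s ^+ 2 = \sum_i v i * (t i - s) ^+ 2.
  have h i : v i * (t i - s) ^+ 2 = v i * t i ^+ 2 - (v i * t i) * (2 * s) + v i * s ^+ 2.
    by ring.
  under [RHS]eq_bigr do rewrite h.
  rewrite big_split /= sumrB -!mulr_suml -/s v_sum1; ring.
by apply: sumr_ge0 => i _; rewrite mulr_ge0 ?sqr_ge0.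
Qed.

(** Since the weights sum to 1, the 1 moves inside the sum; then [sqr_jensen] is applied twice. *)
Lemma quartic_jensen (t : I -> R) :
  (\sum_i v i * t i - 1) ^+ 4 <= \sum_i v i * (t i - 1) ^+ 4.
Proof.
have -> : \sum_i v i * t i - 1 = \sum_i v i * (t i - 1).
  by under [RHS]eq_bigr do rewrite mulrBr mulr1; rewrite sumrB v_sum1.
rewrite (exprM _ 2 2); under [leRHS]eq_bigr do rewrite (exprM _ 2 2).
apply: le_trans (sqr_jensen _); rewrite lerXn2r ?nnegrE ?sqr_ge0 //; last exact: sqr_jensen.
by apply: sumr_ge0 => i _; rewrite mulr_ge0 ?sqr_ge0.
Qed.

End Jensen.

(** * Gaussian mixtures *)

Section DotProduct.
Context {R : realType} {N : nat}.
Implicit Types a b c : 'I_N -> R.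

Lemma dotpC a b : dotp a b = dotp b a.
Proof. by apply: eq_bigr => n _; rewrite mulrC. Qed.

Lemma dotpDr a b c : dotp a (fun n => b n + c n) = dotp a b + dotp a c.
Proof. by rewrite /dotp -big_split; apply: eq_bigr => n _; rewrite mulrDr. Qed.

Lemma dotpDl a b c : dotp (fun n => b n + c n) a = dotp b a + dotp c a.
Proof. by rewrite dotpC dotpDr !(dotpC a). Qed.

Lemma dotpZr a b (k : R) : dotp a (fun n => k * b n) = k * dotp a b.
Proof. by rewrite /dotp mulr_sumr; apply: eq_bigr => n _; rewrite mulrCA. Qed.

Lemma dotpZl a b (k : R) : dotp (fun n => k * b n) a = k * dotp b a.
Proof. by rewrite dotpC dotpZr dotpC. Qed.

Lemma dotp_ge0 a : 0 <= dotp a a.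
Proof. by apply: sumr_ge0 => n _; rewrite -expr2 sqr_ge0. Qed.

Lemma dotp_sum (I : finType) (v : I -> R) (a : I -> 'I_N -> R) :
  dotp (fun n => \sum_i v i * a i n) (fun n => \sum_i v i * a i n) =
  \sum_i \sum_j v i * v j * dotp (a i) (a j).
Proof.
under [RHS]eq_bigr do (under eq_bigr do rewrite /dotp mulr_sumr; rewrite exchange_big).
rewrite exchange_big; apply: eq_bigr => n _ /=.
rewrite mulr_suml; apply: eq_bigr => i _; rewrite mulr_sumr; apply: eq_bigr => j _.
by ring.
Qed.

End DotProduct.

(** * Expectation under the noise and moments of likelihood ratios *)

Section GaussianExpectation.
Context {R : realType} {N : nat} (N0 : R).
Hypothesis N0_gt0 : 0 < N0.
Notation E := ('I_N -> R).
Notation phi := (phi N0).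
Implicit Types (f g : E -> R) (a b : E).

Definition gint f : Prop := good (fun y => phi y * f y).
Definition gexp f : R := intRN (fun y => phi y * f y).

Lemma phi_ge0 (y : E) : 0 <= phi y.
Proof. by apply: prodr_ge0 => n _; rewrite ltW // gauss_gt0. Qed.

Let eqD f g : (fun y => phi y * (f y + g y)) = (fun y => phi y * f y + phi y * g y).
Proof. by apply/funext => y; rewrite mulrDr. Qed.

Let eqZ c f : (fun y => phi y * (c * f y)) = (fun y => c * (phi y * f y)).
Proof. by apply/funext => y; rewrite mulrCA. Qed.

Lemma gintD f g : gint f -> gint g -> gint (fun y => f y + g y).
Proof. by move=> gf gg; rewrite /gint eqD; exact: goodD. Qed.

Lemma gexpD f g : gint f -> gint g -> gexp (fun y => f y + g y) = gexp f + gexp g.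
Proof. by move=> gf gg; rewrite /gexp eqD intRND. Qed.

Lemma gintZ c f : gint f -> gint (fun y => c * f y).
Proof. by move=> gf; rewrite /gint eqZ; exact: goodZ. Qed.

Lemma gexpZ c f : gint f -> gexp (fun y => c * f y) = c * gexp f.
Proof. by move=> gf; rewrite /gexp eqZ intRNZ. Qed.

Lemma gint_le f g : emeas f -> (forall y, `|f y| <= g y) -> gint g -> gint f.
Proof.
move=> mf fg; apply: good_le => [|y]; first by apply: emeasM => //; exact: emeas_phi.
by rewrite normrM (ger0_norm (phi_ge0 y)) ler_wpM2l // phi_ge0.
Qed.

Lemma le_gexp f g : gint f -> gint g -> (forall y, f y <= g y) -> gexp f <= gexp g.
Proof. by move=> gf gg fg; apply: le_intRN => // y; rewrite ler_wpM2l // phi_ge0. Qed.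

(* Log-likelihood ratio of the mean [a] against the mean [0]. *)
Definition llr a (y : E) : R := 2 / N0 * dotp y a - dotp a a / N0.

Let llr_mul (k : R) a : (fun y => phi y * expR (k * llr a y)) =
  (fun y => phi y * expR (2 / N0 * dotp y (fun n => k * a n) + - (k * (dotp a a / N0)))).
Proof. by apply/funext => y; rewrite dotpZr /llr; congr (_ * expR _); ring. Qed.

Lemma gint_expR (k : R) a : gint (fun y => expR (k * llr a y)).
Proof. by rewrite /gint llr_mul; exact: good_tilt. Qed.

(** The tilt contributes [k^2 |a|^2 / N0] and the normalisation in [llr] subtracts [k |a|^2 / N0].
    At [k = 1] the likelihood ratio has mean 1. *)
Lemma gexp_expR (k : R) a :
  gexp (fun y => expR (k * llr a y)) = expR ((k ^+ 2 - k) * (dotp a a / N0)).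
Proof.
by rewrite /gexp llr_mul intRN_tilt // dotpZr dotpZl; congr expR; ring.
Qed.

Let llr_add a b : (fun y => phi y * expR (llr a y + llr b y)) =
  (fun y => phi y * expR (2 / N0 * dotp y (fun n => a n + b n) +
     - (dotp a a / N0 + dotp b b / N0))).
Proof. by apply/funext => y; rewrite dotpDr /llr; congr (_ * expR _); ring. Qed.

Lemma gint_expR2 a b : gint (fun y => expR (llr a y + llr b y)).
Proof. by rewrite /gint llr_add; exact: good_tilt. Qed.

(** Only the cross term of [|a + b|^2 - |a|^2 - |b|^2] survives in the exponent. *)
Lemma gexp_expR2 a b :
  gexp (fun y => expR (llr a y + llr b y)) = expR (2 * (dotp a b / N0)).
Proof.
rewrite /gexp llr_add intRN_tilt // dotpDr !dotpDl (dotpC b a); congr expR; ring.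
Qed.

Lemma gint1 : gint (fun=> 1).
Proof.
have := gint_expR 0 (fun=> 0).
by under eq_fun do rewrite mul0r expR0.
Qed.

Lemma gexp1 : gexp (fun=> 1) = 1.
Proof.
have := gexp_expR 0 (fun=> 0).
under eq_fun do rewrite mul0r expR0.
by rewrite expr0n subrr mul0r expR0.
Qed.

Lemma gint_gexp_sum (I : finType) (f : I -> E -> R) : (forall i, gint (f i)) ->
  gint (fun y => \sum_i f i y) /\ gexp (fun y => \sum_i f i y) = \sum_i gexp (f i).
Proof.
move=> gf; have := good_intRN_sum (index_enum I) gint1 gf.
rewrite /gint /gexp (_ : (fun y => \sum_i phi y * f i y) =
  (fun y => phi y * \sum_i f i y)) //.
by apply/funext => y; rewrite mulr_sumr.
Qed.

Lemma gint_sum (I : finType) (f : I -> E -> R) : (forall i, gint (f i)) ->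
  gint (fun y => \sum_i f i y).
Proof. by move=> gf; have [] := gint_gexp_sum gf. Qed.

Lemma gexp_sum (I : finType) (f : I -> E -> R) : (forall i, gint (f i)) ->
  gexp (fun y => \sum_i f i y) = \sum_i gexp (f i).
Proof. by move=> gf; have [] := gint_gexp_sum gf. Qed.

End GaussianExpectation.

(** * Relative entropy of a Gaussian mixture *)

Section Mixture.
Context {R : realType} {N : nat} {I : finType}.
Notation E := ('I_N -> R).
Implicit Types (v : I -> R) (a : I -> E).

Definition mix N0 v a (y : E) : R := \sum_i v i * expR (llr N0 (a i) y).

(** For a probability vector [v], this is the Kullback-Leibler divergence, in nats, of the mixture
    of Gaussians with means [a i] from the pure noise. *)
Definition mixH N0 v a : R := gexp N0 (fun y => xlnx (mix N0 v a y)).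

Lemma measurable_mix d (V : measurableType d) N0 v (A : V -> I -> E) (Y : V -> E) :
  (forall i n, measurable_fun setT (fun u => A u i n)) ->
  (forall n, measurable_fun setT (fun u => Y u n)) ->
  measurable_fun setT (fun u => mix N0 v (A u) (Y u)).
Proof.
move=> mA mY; apply: measurable_sum => i; apply: measurable_funM => //.
apply: measurableT_comp => //; apply: measurable_funB; apply: measurable_funM => //;
  by apply: measurable_sum => n; exact: measurable_funM.
Qed.

Lemma measurable_xlnx : measurable_fun setT (@xlnx R).
Proof. by apply: measurable_funM => //; exact: measurable_ln. Qed.

Lemma measurable_mixH d (V : measurableType d) N0 v (A : V -> I -> E) :
  (forall i n, measurable_fun setT (fun u => A u i n)) ->
  measurable_fun setT (fun u => mixH N0 v (A u)).
Proof.
move=> mA; apply: (measurable_iint N (G := fun u y => phi N0 y * xlnx (mix N0 v (A u) y))).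
move=> d' W b Y mb mY; apply: measurable_funM; first exact: emeas_phi.
apply: (measurableT_comp measurable_xlnx); apply: measurable_mix => // i n.
exact: (measurableT_comp (mA i n) mb).
Qed.

Section Fixed.
Variables (N0 : R) (v : I -> R) (a : I -> E).
Hypothesis N0_gt0 : 0 < N0.
Hypothesis v_ge0 : forall i, 0 <= v i.
Hypothesis v_sum1 : \sum_i v i = 1.
Notation mix := (mix N0 v a).
Notation llr := (llr N0).
Notation gint := (gint N0).
Notation gexp := (gexp N0).

Lemma emeas_mix : emeas mix.
Proof. by move=> d V Y mY; apply: (@measurable_mix _ V N0 v (fun=> a) Y). Qed.

Lemma mix_gt0 y : 0 < mix y.
Proof. by apply: convex_comb_gt0 => // i; exact: expR_gt0. Qed.

Let gint_L i : gint (fun y => expR (llr (a i) y)).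
Proof. by have := gint_expR N0_gt0 1 (a i); under eq_fun do rewrite mul1r. Qed.

Let gexp_L i : gexp (fun y => expR (llr (a i) y)) = 1.
Proof.
have := gexp_expR N0_gt0 1 (a i); under eq_fun do rewrite mul1r.
by rewrite expr1n subrr mul0r expR0.
Qed.

Lemma gint_mix : gint mix.
Proof. by apply: gint_sum => // i; exact: gintZ. Qed.

Lemma gexp_mix : gexp mix = 1.
Proof.
rewrite /mix gexp_sum //; last by move=> i; exact: gintZ.
by under eq_bigr do rewrite gexpZ // gexp_L mulr1.
Qed.

Let mix_sqr y : mix y ^+ 2 =
  \sum_i \sum_j v i * v j * expR (llr (a i) y + llr (a j) y).
Proof.
rewrite expr2 mulr_suml; apply: eq_bigr => i _; rewrite mulr_sumr.
by apply: eq_bigr => j _; rewrite expRD; ring.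
Qed.

Lemma gint_mix_sqr : gint (fun y => mix y ^+ 2).
Proof.
under eq_fun do rewrite mix_sqr.
by do 2 (apply: gint_sum => // ?); apply: gintZ; exact: gint_expR2.
Qed.

Lemma gexp_mix_sqr : gexp (fun y => mix y ^+ 2) =
  \sum_i \sum_j v i * v j * expR (2 * (dotp (a i) (a j) / N0)).
Proof.
under eq_fun do rewrite mix_sqr.
have g2 i j : gint (fun y => v i * v j * expR (llr (a i) y + llr (a j) y)).
  by apply: gintZ; exact: gint_expR2.
rewrite gexp_sum //; last by move=> i; exact: gint_sum.
apply: eq_bigr => i _; rewrite gexp_sum //; apply: eq_bigr => j _.
by rewrite gexpZ ?gexp_expR2 //; exact: gint_expR2.
Qed.

Lemma gint_xlnx_mix : gint (fun y => xlnx (mix y)).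
Proof.
apply: (@gint_le _ _ _ N0_gt0 _ (fun y => 1 + mix y ^+ 2)).
- by move=> d V Y mY; apply: (measurableT_comp measurable_xlnx); exact: emeas_mix.
- by move=> y; apply: xlnx_norm_le; exact: mix_gt0.
- by apply: gintD; [exact: gint1 | exact: gint_mix_sqr].
Qed.

Lemma mixH_ge0 : 0 <= mixH N0 v a.
Proof.
have -> : 0 = gexp (fun y => mix y + (-1) * 1).
  rewrite gexpD; [|exact: gint_mix|by apply: gintZ; exact: gint1].
  by rewrite gexp_mix gexpZ ?gexp1 ?mulr1 ?subrr //; exact: gint1.
apply: le_gexp => //.
- by apply: gintD; [exact: gint_mix | apply: gintZ; exact: gint1].
- exact: gint_xlnx_mix.
- by move=> y; rewrite mulr1; apply: xlnx_ge; exact: mix_gt0.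
Qed.

(** Jensen over the mixture reduces to one symbol, where [mul_expR_le] holds for every [e] and
    [expR_div_bound] picks a good one. The bound is linear in [1 / N0] at every noise level, which
    dominated convergence over the fading requires. *)
Lemma mixH_le : mixH N0 v a <= 2 * expR 2 * \sum_i v i * (dotp (a i) (a i) / N0).
Proof.
have gL (e : R) i : gint (fun y =>
    e^-1 * (expR ((1 + e) * llr (a i) y) + (-1) * expR (llr (a i) y))).
  by apply: gintZ; apply: gintD; [exact: gint_expR | exact: gintZ].
have gll i : gint (fun y => xlnx (expR (llr (a i) y))).
  apply: (@gint_le _ _ _ N0_gt0 _ (fun y => 1 + expR (2 * llr (a i) y))).
  - move=> d V Y mY; apply: (measurableT_comp measurable_xlnx).
    apply: measurableT_comp => //; apply: measurable_funB => //.
    by apply: measurable_funM => //; exact: emeas_dotp.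
  - by move=> y; rewrite expRM_natl; apply: xlnx_norm_le; exact: expR_gt0.
  - by apply: gintD; [exact: gint1 | exact: gint_expR].
apply: (@le_trans _ _ (\sum_i v i * gexp (fun y => xlnx (expR (llr (a i) y))))).
  rewrite (eq_bigr (fun i => gexp (fun y => v i * xlnx (expR (llr (a i) y))))); last first.
    by move=> i _; rewrite gexpZ.
  rewrite -gexp_sum //; last by move=> i; exact: gintZ.
  apply: le_gexp => //; first exact: gint_xlnx_mix.
    by apply: gint_sum => // i; exact: gintZ.
  by move=> y; apply: xlnx_jensen => // i; exact: expR_gt0.
rewrite mulr_sumr; apply: ler_sum => i _; rewrite mulrCA; apply: ler_wpM2l => //.
apply: expR_div_bound; first by rewrite divr_ge0 ?dotp_ge0 // ltW.
move=> e e0.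
(* The exponent is [k^2 - k] at [k = 1 + e]; the subtracted likelihood ratio has mean 1. *)
have -> : e^-1 * (expR (e * (1 + e) * (dotp (a i) (a i) / N0)) - 1) =
  gexp (fun y => e^-1 * (expR ((1 + e) * llr (a i) y) + (-1) * expR (llr (a i) y))).
  rewrite gexpZ; last by apply: gintD; [exact: gint_expR | exact: gintZ].
  rewrite gexpD; [|exact: gint_expR|exact: gintZ].
  rewrite gexpZ; last exact: gint_L.
  rewrite gexp_L gexp_expR // mulr1; congr (_ * (expR _ - _)); ring.
apply: le_gexp => // y; rewrite mulN1r /xlnx expRK; exact: mul_expR_le.
Qed.

(** The second moment of [mix - 1] under the noise, that is, the chi-square divergence of the
    mixture. *)
Definition quad : R := \sum_i \sum_j v i * v j * (expR (2 * (dotp (a i) (a j) / N0)) - 1).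
(** The fourth moment of [L - 1] for one symbol with [A = |a|^2 / N0]: the powers [k = 4, 3, 2] give
    the exponents [k^2 - k = 12, 6, 2], and [k = 1, 0] give [-4 + 1 = -3]. *)
Definition quart (A : R) : R := expR (12 * A) - 4 * expR (6 * A) + 6 * expR (2 * A) - 3.

Let gint_sub1_sqr : gint (fun y => (mix y - 1) ^+ 2).
Proof.
rewrite (_ : (fun y => _) = (fun y => mix y ^+ 2 + ((-2) * mix y + 1))).
  apply: gintD; first exact: gint_mix_sqr.
  by apply: gintD; [apply: gintZ; exact: gint_mix | exact: gint1].
by apply/funext => y; ring.
Qed.

Let gexp_sub1_sqr : gexp (fun y => (mix y - 1) ^+ 2) = quad.
Proof.
rewrite (_ : (fun y => _) = (fun y => mix y ^+ 2 + ((-2) * mix y + 1))); last first.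
  by apply/funext => y; ring.
have g0 : gint (fun y => -2 * mix y) by apply: gintZ; exact: gint_mix.
have g1 : gint (fun y => -2 * mix y + 1) by apply: gintD => //; exact: gint1.
rewrite gexpD //; last exact: gint_mix_sqr.
rewrite gexpD //; last exact: gint1.
rewrite gexpZ; last exact: gint_mix.
rewrite gexp1 // gexp_mix gexp_mix_sqr /quad.
under [RHS]eq_bigr do
  (under eq_bigr do rewrite mulrBr mulr1; rewrite sumrB -mulr_sumr v_sum1 mulr1).
rewrite sumrB v_sum1; ring.
Qed.

Let quart_expand i : (fun y => (expR (llr (a i) y) - 1) ^+ 4) =
  (fun y => expR (4 * llr (a i) y) + ((-4) * expR (3 * llr (a i) y) +
    (6 * expR (2 * llr (a i) y) + ((-4) * expR (1 * llr (a i) y) + 1)))).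
Proof. by apply/funext => y; rewrite mul1r !expRM_natl; ring. Qed.

Let gint_quart i : gint (fun y => (expR (llr (a i) y) - 1) ^+ 4).
Proof.
rewrite quart_expand; apply: gintD; first exact: gint_expR.
do 3 (apply: gintD; first by apply: gintZ; exact: gint_expR).
exact: gint1.
Qed.

Let gexp_quart i : gexp (fun y => (expR (llr (a i) y) - 1) ^+ 4) =
  quart (dotp (a i) (a i) / N0).
Proof.
have gk (c k : R) : gint (fun y => c * expR (k * llr (a i) y)).
  by apply: gintZ; exact: gint_expR.
have g1 : gint (fun _ : E => 1) by exact: gint1.
rewrite quart_expand gexpD; [|exact: gint_expR|by do 3 apply: gintD => //].
rewrite gexpD //; last by do 2 apply: gintD => //.
rewrite gexpD //; last by apply: gintD.
rewrite gexpD // !gexpZ; try exact: gint_expR.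
rewrite gexp1 // !gexp_expR // /quart.
rewrite (_ : 4 ^+ 2 - 4 = 12 :> R); last by ring.
rewrite (_ : 3 ^+ 2 - 3 = 6 :> R); last by ring.
rewrite (_ : 2 ^+ 2 - 2 = 2 :> R); last by ring.
rewrite (_ : 1 ^+ 2 - 1 = 0 :> R); last by ring.
rewrite mul0r expR0; ring.
Qed.

(** This is the expectation of [xlnx_taylor] at [t = mix y]: the linear term has mean zero, the
    square gives [quad], and [quartic_jensen] reduces the fourth power to single symbols. *)
Lemma mixH_taylor (e : R) : 0 < e ->
  `|mixH N0 v a - quad / 2| <=
  e * quad + 16 / e * \sum_i v i * quart (dotp (a i) (a i) / N0).
Proof.
move=> e0.
pose q y := (mix y - 1) ^+ 2.
pose F y := \sum_i v i * (expR (llr (a i) y) - 1) ^+ 4.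
have gF : gint F by apply: gint_sum => // i; exact: gintZ.
have eF : gexp F = \sum_i v i * quart (dotp (a i) (a i) / N0).
  rewrite gexp_sum //; last by move=> i; exact: gintZ.
  by apply: eq_bigr => i _; rewrite gexpZ ?gexp_quart.
have gm : gint (fun y => mix y + (-1) * 1).
  by apply: gintD; [exact: gint_mix | apply: gintZ; exact: gint1].
have em : gexp (fun y => mix y + (-1) * 1) = 0.
  rewrite gexpD; [|exact: gint_mix|by apply: gintZ; exact: gint1].
  by rewrite gexp_mix gexpZ ?gexp1 ?mulr1 ?subrr //; exact: gint1.
(* Both comparison functions have this form: [c = 1/2 - e], [k = - 16/e] from below and
   [c = 1/2 + e], [k = 16/e] from above. *)
have gG (c k : R) : gint (fun y => (mix y + (-1) * 1) + (c * q y + k * F y)).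
  by apply: gintD => //; apply: gintD; exact: gintZ.
have eG (c k : R) : gexp (fun y => (mix y + (-1) * 1) + (c * q y + k * F y)) =
   c * quad + k * \sum_i v i * quart (dotp (a i) (a i) / N0).
  rewrite gexpD //; last by apply: gintD; exact: gintZ.
  by rewrite em add0r gexpD ?gexpZ ?eF ?gexp_sub1_sqr //; exact: gintZ.
have pt y : `|xlnx (mix y) - (mix y - 1) - q y / 2| <= e * q y + 16 / e * F y.
  apply: le_trans (xlnx_taylor e0 (mix_gt0 y)) _; rewrite lerD2l.
  by apply: ler_wpM2l; [rewrite divr_ge0 // ltW | exact: quartic_jensen].
rewrite ler_norml; apply/andP; split.
- have : gexp (fun y => (mix y + (-1) * 1) + ((1 / 2 - e) * q y + (- (16 / e)) * F y)) <=
    mixH N0 v a.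
    apply: le_gexp => //; first exact: gint_xlnx_mix.
    by move=> y; have := pt y; rewrite ler_norml => /andP[]; lra.
  by rewrite eG; lra.
- have : mixH N0 v a <=
    gexp (fun y => (mix y + (-1) * 1) + ((1 / 2 + e) * q y + (16 / e) * F y)).
    apply: le_gexp => //; first exact: gint_xlnx_mix.
    by move=> y; have := pt y; rewrite ler_norml => /andP[]; lra.
  by rewrite eG; lra.
Qed.

End Fixed.
End Mixture.

(** * Integration against a density *)

Section Density.
Context {R : realType} {d : measure_display} {T : measurableType d}.
Variables (P : probability T R) (X : T -> R) (p : R -> R).
Notation lam := (@lebesgue_measure R).
Hypothesis X_meas : measurable_fun setT X.
Hypothesis p_meas : measurable_fun setT p.
Hypothesis law : forall A : set R, measurable A ->
  P (X @^-1` A) = (\int[lam]_(t in A) (p t)%:E)%E.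

(** By [law], the distribution of [X] is absolutely continuous, and its Radon-Nikodym derivative has
    the same integral as [p] over every measurable set. Hence the two agree almost everywhere, and
    change of variables concludes. *)
Lemma ge0_integral_density (f : R -> R) : measurable_fun setT f ->
  (forall t, 0 <= f t) ->
  (\int[P]_w (f (X w))%:E = \int[lam]_t (f t * p t)%:E)%E.
Proof.
move=> mf f0.
have X_meas' : @measurable_fun _ _ T (measurableTypeR R) setT X by exact: X_meas.
pose Xm : {mfun T >-> measurableTypeR R} :=
  HB.pack X (isMeasurableFun.Build _ _ _ _ _ X_meas').
pose nu : {finite_measure set (measurableTypeR R) -> \bar R} := distribution P Xm.
have mf' : measurable_fun setT (EFin \o f) by exact/measurable_EFinP.
have mp' : measurable_fun setT (EFin \o p) by exact/measurable_EFinP.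
have ac : nu `<< lam.
  apply/null_content_dominatesP => A mA A0.
  have -> : nu A = P (X @^-1` A) by [].
  by rewrite law // null_set_integral //; exact: measurable_funTS.
have <- := ge0_integral_distribution Xm mf' (fun t => f0 t).
rewrite -(Radon_Nikodym_SigmaFinite.change_of_variables ac) //.
pose g := Radon_Nikodym_SigmaFinite.f nu lam.
have ig : lam.-integrable setT g by exact: Radon_Nikodym_SigmaFinite.f_integrable.
have mg : measurable_fun setT g by exact: measurable_int ig.
have gp : ae_eq lam setT g (EFin \o p).
  apply: integral_ae_eq => // A _ mA.
  by rewrite -Radon_Nikodym_SigmaFinite.f_integral // -law.
apply: (@ae_eq_integral _ (measurableTypeR R) R lam setT
  (fun t => (f t)%:E * (p t)%:E)%E (fun t => (f t)%:E * g t)%E) => //.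
- exact: emeasurable_funM.
- exact: emeasurable_funM.
- exact: ae_eqe_mul2l.
Qed.

Lemma integrable_sqr_density : lam.-integrable setT (fun t => (t ^+ 2 * p t)%:E) ->
  P.-integrable setT (fun w => (X w ^+ 2)%:E) /\
  Rintegral P setT (fun w => X w ^+ 2) = EH2 p.
Proof.
move=> ip.
have E := ge0_integral_density (f := fun t => t ^+ 2) (exprn_measurable 2) (@sqr_ge0 R).
split; last by rewrite /Rintegral /EH2 /Rintegral E.
apply/integrableP; split.
  by apply/measurable_EFinP; apply: measurable_funX.
under eq_integral do rewrite gee0_abs ?lee_fin ?sqr_ge0 //.
rewrite E.
have := integrable_fin_num measurableT ip.
by rewrite fin_numE => /andP[_]; rewrite ltey.
Qed.
End Density.

(** * Low-SNR limits *)

Section Slopes.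
Context {R : realType}.

Lemma near_right0_gt0 : \forall s \near (0 : R)^'+, 0 < s.
Proof. exact: nbhs_right_gt. Qed.

Lemma cvg_right_sum (I : finType) (f : I -> R -> R) (l : I -> R) :
  (forall i, f i s @[s --> 0^'+] --> l i) ->
  \sum_i f i s @[s --> 0^'+] --> \sum_i l i.
Proof.
move=> h; apply: (@cvg_big R I +%R 0 xpredT (@add_continuous R)) => // i _; exact: h.
Qed.

(** For [s > 0] the quotient lies between [k] and [k exp (k s)], by [1 + z <= exp z] at [z = k s]
    and [z = - k s]. *)
Lemma expR_slope (k : R) : (expR (k * s) - 1) / s @[s --> 0^'+] --> k.
Proof.
apply: (@squeeze_cvgr _ _ _ _ (fun=> k) (fun s => k * expR (k * s))).
- near=> s; have s0 : 0 < s by near: s; exact: near_right0_gt0.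
  rewrite ler_pdivlMr // ler_pdivrMr //; apply/andP; split.
    by have := expR_ge1Dx (k * s); lra.
  have := expR_ge1Dx (- (k * s)); rewrite -(ler_pM2r (expR_gt0 (k * s))).
  by rewrite -expRD addNr expR0 mulrAC; lra.
- exact: cvg_cst.
- rewrite -[X in _ --> X]mulr1 -expR0 -{2}[0](mulr0 k).
  apply: cvgM; first exact: cvg_cst.
  apply: continuous_cvg; first exact: continuous_expR.
  apply: cvgM; first exact: cvg_cst.
  exact: cvg_at_right_filter.
Unshelve. all: by end_near. Qed.

(** The error [e * q s] is small with [e] because [q] stays bounded near 0, and for a fixed [e] the
    other error tends to 0. So [e] is chosen before [s]. *)
Lemma squeeze_eps (u q f : R -> R) (l : R) :
  (forall e s, 0 < e -> 0 < s -> `|u s - q s / 2| <= e * q s + 16 / e * f s) ->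
  q s @[s --> 0^'+] --> 2 * l -> f s @[s --> 0^'+] --> 0 ->
  u s @[s --> 0^'+] --> l.
Proof.
move=> h /cvgrPdist_le qc /cvgrPdist_le fc; apply/cvgrPdist_le => eta eta0.
pose K := `|2 * l| + 1; have K0 : 0 < K by rewrite /K ltr_wpDl.
(* Near 0 one has [q s <= K], so [e * q s], the term in [f] and [|q s / 2 - l|] are each at most
   [eta / 4]. *)
pose e := eta / (4 * K); have e0 : 0 < e by rewrite divr_gt0 // mulr_gt0.
near=> s; have s0 : 0 < s by near: s; exact: near_right0_gt0.
have q1 : `|2 * l - q s| <= 1 by near: s; exact: qc.
have q2 : `|2 * l - q s| <= eta / 2 by near: s; apply: qc; rewrite divr_gt0.
have f1 : `|0 - f s| <= eta * e / 64.
  by near: s; apply: fc; rewrite divr_gt0 // mulr_gt0.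
have qK : q s <= K.
  have := ler_norm (2 * l); move: q1; rewrite /K ler_norml; lra.
have eq : e * q s <= eta / 4.
  apply: (@le_trans _ _ (e * K)); first by rewrite ler_pM2l.
  by rewrite /e le_eqVlt; apply/orP; left; apply/eqP; field; rewrite gt_eqF.
have ef : 16 / e * f s <= eta / 4.
  have fs : f s <= eta * e / 64 by move: f1; rewrite ler_norml; lra.
  have e16 : 0 < 16 / e by rewrite divr_gt0.
  have := ler_wpM2l (ltW e16) fs.
  rewrite (_ : 16 / e * (eta * e / 64) = eta / 4) //.
  by field; rewrite gt_eqF.
have := h e s e0 s0; move: q2; rewrite !ler_norml; lra.
Unshelve. all: by end_near. Qed.

(** The first-order terms cancel: [12 - 4 * 6 + 6 * 2 = 0]. *)
Lemma quart_slope (k : R) : quart (k * s) / s @[s --> 0^'+] --> 0.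
Proof.
have E : (fun s : R => quart (k * s) / s) =
  (fun s => ((expR (12 * k * s) - 1) / s - 4 * ((expR (6 * k * s) - 1) / s)) +
     6 * ((expR (2 * k * s) - 1) / s)).
  by apply/funext => s; rewrite /quart -!mulrA; ring.
rewrite E [X in _ --> X](_ : 0 = 12 * k - 4 * (6 * k) + 6 * (2 * k)); last by ring.
apply: cvgD; first apply: cvgB.
- exact: expR_slope.
- by apply: cvgM; [exact: cvg_cst | exact: expR_slope].
- by apply: cvgM; [exact: cvg_cst | exact: expR_slope].
Qed.

Context {N : nat} {I : finType}.
Variables (v : I -> R) (a : I -> 'I_N -> R) (c : R).
Hypothesis c_gt0 : 0 < c.
Hypothesis v_ge0 : forall i, 0 <= v i.
Hypothesis v_sum1 : \sum_i v i = 1.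

Let div_div (A s : R) : A / (c / s) = A / c * s.
Proof. by rewrite invf_div mulrA mulrAC. Qed.

(** With [N0 = c / s] each term is an exponential of slope [2 <a_i, a_j> / c]; the double sum is
    then the squared norm of the mean of [a]. *)
Lemma quad_slope : quad (c / s) v a / s @[s --> 0^'+] -->
  2 * (c^-1 * dotp (fun n => \sum_i v i * a i n) (fun n => \sum_i v i * a i n)).
Proof.
rewrite dotp_sum.
have -> : 2 * (c^-1 * \sum_i \sum_j v i * v j * dotp (a i) (a j)) =
   \sum_i \sum_j v i * v j * (2 * (dotp (a i) (a j) / c)).
  rewrite !mulr_sumr; apply: eq_bigr => i _; rewrite !mulr_sumr.
  by apply: eq_bigr => j _; ring.
have -> : (fun s : R => quad (c / s) v a / s) = (fun s => \sum_i \sum_j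
    v i * v j * ((expR (2 * (dotp (a i) (a j) / c) * s) - 1) / s)).
  apply/funext => s; rewrite /quad mulr_suml; apply: eq_bigr => i _.
  rewrite mulr_suml; apply: eq_bigr => j _.
  by rewrite div_div !mulrA.
apply: cvg_right_sum => i; apply: cvg_right_sum => j.
by apply: cvgM; [exact: cvg_cst | exact: expR_slope].
Qed.

Lemma mixH_slope : mixH (c / s) v a / s @[s --> 0^'+] -->
  c^-1 * dotp (fun n => \sum_i v i * a i n) (fun n => \sum_i v i * a i n).
Proof.
apply: (squeeze_eps (q := fun s => quad (c / s) v a / s)
  (f := fun s => \sum_i v i * (quart (dotp (a i) (a i) / c * s) / s))).
- move=> e s e0 s0; have cs : 0 < c / s by rewrite divr_gt0.
  have := mixH_taylor a cs v_ge0 v_sum1 e0.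
  rewrite -(ler_pM2r (_ : 0 < s^-1)) ?invr_gt0 //.
  have -> : `|mixH (c / s) v a / s - quad (c / s) v a / s / 2| =
     `|mixH (c / s) v a - quad (c / s) v a / 2| / s.
    have si : `|s^-1| = s^-1 by rewrite gtr0_norm ?invr_gt0.
    have -> (p q : R) : p / s - q / s / 2 = (p - q / 2) / s by ring.
    by rewrite normrM si.
  move=> /le_trans; apply; rewrite le_eqVlt; apply/orP; left; apply/eqP.
  rewrite mulrDl -!mulrA; congr (_ + _ * (_ * _)); rewrite mulr_suml.
  by apply: eq_bigr => i _; rewrite div_div !mulrA.
- exact: quad_slope.
- rewrite [X in _ --> X](_ : 0 = \sum_i v i * 0); last by rewrite -mulr_suml mulr0.
  apply: cvg_right_sum => i; apply: cvgM; first exact: cvg_cst.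
  exact: quart_slope.
Qed.

End Slopes.

(** * Averaging the low-SNR limit over the fading *)

Section Expectation.
Context {R : realType} {N : nat} {I : finType}.
Context {d : measure_display} {T : measurableType d}.
Variables (P : probability T R) (H : 'I_N -> T -> R) (h2 : R).
Hypothesis H_meas : forall n, measurable_fun setT (H n).
Hypothesis H_sqr : forall n, P.-integrable setT (fun w => (H n w ^+ 2)%:E) /\
  Rintegral P setT (fun w => H n w ^+ 2) = h2.
Variables (v : I -> R) (x : I -> 'I_N -> R).
Hypothesis v_ge0 : forall i, 0 <= v i.
Hypothesis v_sum1 : \sum_i v i = 1.

Let a w i n := H n w * x i n.

Let dotp_a w (b : 'I_N -> R) :
  dotp (fun n => H n w * b n) (fun n => H n w * b n) = \sum_n (b n ^+ 2) * (H n w ^+ 2).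
Proof. by apply: eq_bigr => n _; ring. Qed.

(** Only the squares [H n ^+ 2] occur, never products of distinct coordinates, so the common second
    moment [h2] determines the expectation. *)
Let quad_form (b : 'I_N -> R) :
  P.-integrable setT (fun w => (\sum_n (b n) * (H n w ^+ 2))%:E) /\
  Rintegral P setT (fun w => \sum_n (b n) * (H n w ^+ 2)) = h2 * \sum_n b n.
Proof.
have iH n : P.-integrable setT (EFin \o (fun w => H n w ^+ 2)) by have [] := H_sqr n.
have ih n : P.-integrable setT (fun w => (b n)%:E * (H n w ^+ 2)%:E)%E.
  by apply: integrableZl => //; exact: iH.
have E : (fun w => (\sum_n (b n) * (H n w ^+ 2))%:E) =
  (fun w => \sum_n (b n)%:E * (H n w ^+ 2)%:E)%E.
  by apply/funext => w; rewrite -sumEFin.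
split; first by rewrite E; exact: integrable_sum.
rewrite /Rintegral E integral_sum //.
rewrite (eq_bigr (fun n => (b n * h2)%:E)); last first.
  move=> n _; have [i1 e1] := H_sqr n.
  rewrite (integralZl measurableT i1) EFinM -e1 /Rintegral fineK //.
  exact: (integrable_fin_num measurableT i1).
by rewrite sumEFin /= -mulr_suml mulrC.
Qed.

Let a_meas i n : measurable_fun setT (fun w => a w i n).
Proof. exact: measurable_funM. Qed.

(** Coefficient of [H n ^+ 2] in the bound of [mixH_le], after exchanging the sums over symbols and
    coordinates. *)
Let bnd := fun n => 2 * expR 2 * \sum_i v i * x i n ^+ 2.

Let mixH_bound (N0 : R) w : 0 < N0 ->
  `|mixH N0 v (a w)| <= N0^-1 * \sum_n bnd n * (H n w ^+ 2).
Proof.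
move=> N0p; rewrite ger0_norm; last exact: mixH_ge0.
apply: le_trans (mixH_le _ N0p v_ge0 v_sum1) _.
rewrite le_eqVlt; apply/orP; left; apply/eqP.
under eq_bigr do rewrite dotp_a.
rewrite /bnd.
under [in RHS]eq_bigr do rewrite -mulrA mulr_suml.
rewrite -mulr_sumr exchange_big [RHS]mulrCA; congr (_ * _).
rewrite [RHS]mulr_sumr; apply: eq_bigr => i _ /=.
rewrite mulrA mulrC mulr_sumr; congr (_ * _); apply: eq_bigr => n _; ring.
Qed.

Lemma integrable_mixH (N0 : R) : 0 < N0 ->
  P.-integrable setT (EFin \o (fun w => mixH N0 v (a w))).
Proof.
move=> N0p.
have iG : P.-integrable setT (fun w => (N0^-1)%:E * (\sum_n bnd n * (H n w ^+ 2))%:E)%E.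
  by apply: integrableZl => //; have [] := quad_form bnd.
apply: le_integrable iG => //.
  by apply/measurable_EFinP; exact: measurable_mixH.
move=> w _ /=; rewrite lee_fin; apply: le_trans (mixH_bound w N0p) _.
exact: ler_norm.
Qed.

Lemma expect_mixH_slope (c : R) : 0 < c ->
  Rintegral P setT (fun w => mixH (c / s) v (a w)) / s @[s --> 0^'+] -->
  c^-1 * (h2 * \sum_n (\sum_i v i * x i n) ^+ 2).
Proof.
(* The right limit is tested along positive sequences, the setting of dominated convergence. *)
move=> c0; apply/cvg_at_rightP => u [u0 uc].
pose mu n := \sum_i v i * x i n.
pose f := fun w => c^-1 * \sum_n (mu n ^+ 2) * (H n w ^+ 2).
have fE : Rintegral P setT f = c^-1 * (h2 * \sum_n mu n ^+ 2).
  have [i1 e1] := quad_form (fun n => mu n ^+ 2).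
  by rewrite RintegralZl // e1.
rewrite -fE.
have cu n : 0 < c / u n by rewrite divr_gt0.
have E n : Rintegral P setT (fun w => mixH (c / u n) v (a w)) / u n =
  Rintegral P setT (fun w => mixH (c / u n) v (a w) / u n).
  by rewrite RintegralZr //; exact: integrable_mixH.
under eq_fun do rewrite E.
have [|||||i1 _ e1] := @dominated_convergence _ T R P setT measurableT
  (fun n w => (mixH (c / u n) v (a w) / u n)%:E) (fun w => (f w)%:E)
  (fun w => (c^-1 * \sum_n bnd n * (H n w ^+ 2))%:E).
- move=> n; apply/measurable_EFinP; apply: measurable_funM => //.
  exact: measurable_mixH.
- apply/measurable_EFinP; apply: measurable_funM => //; apply: measurable_sum => n.
  by apply: measurable_funM => //; exact: measurable_funX.
- apply: aeW => w _; apply: cvg_EFin; first exact: nearW.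
  have := @mixH_slope R N I v (a w) c c0 v_ge0 v_sum1.
  rewrite (_ : dotp _ _ = \sum_n (mu n ^+ 2) * (H n w ^+ 2)); last first.
    rewrite -dotp_a; congr (dotp _ _); apply/funext => n; rewrite /mu mulr_sumr;
      by apply: eq_bigr => i _; rewrite mulrCA.
  move/cvg_at_rightP => /(_ u); apply; split => //.
- under eq_fun do rewrite EFinM.
  by apply: integrableZl => //; have [] := quad_form bnd.
(* At [N0 = c / u n] the bound is proportional to [u n], which cancels the division and leaves a
   bound independent of [n]. *)
- apply: aeW => w n _; rewrite lee_fin normrM (gtr0_norm (_ : 0 < (u n)^-1)) ?invr_gt0 //.
  rewrite ler_pdivrMr //; apply: le_trans (mixH_bound w (cu n)) _.
  by rewrite invf_div le_eqVlt; apply/orP; left; apply/eqP; ring.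
have fin : (\int[P]_w (f w)%:E)%E \is a fin_num by exact: integrable_fin_num.
move: e1; rewrite -(fineK fin) => /fine_cvgP[_]; exact.
Qed.

End Expectation.

(** * Functions of independent bits *)

Section Bits.

(** Induction on [m]: bit 0 is the parity, and the remaining bits are those of the half. *)
Lemma bits_inj m : forall i j, (i < 2 ^ m)%N -> (j < 2 ^ m)%N ->
  (forall k, (k < m)%N -> bit i k = bit j k) -> i = j.
Proof.
elim: m => [|m IH] i j; first by rewrite expn0 !ltnS !leqn0 => /eqP-> /eqP->.
move=> im jm h; rewrite -(odd_double_half i) -(odd_double_half j).
have := h 0%N isT; rewrite /bit expn0 !divn1 => ->.
have half_lt n : (n < 2 ^ m.+1)%N -> (n./2 < 2 ^ m)%N.
  by rewrite expnS mul2n -!divn2 ltn_divLR // -muln2.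
congr (_ + _.*2)%N; apply: IH; rewrite ?half_lt // => k km.
by have := h k.+1 km; rewrite /bit expnS !divnMA !divn2.
Qed.

Lemma bit0n k : bit 0 k = false.
Proof. by rewrite /bit div0n. Qed.

Lemma bit_exp2 k l : bit (2 ^ k) l = (l == k).
Proof.
rewrite /bit; case: ltngtP => [lk|kl|->]; last by rewrite divnn expn_gt0.
- by rewrite -expnB ?(ltnW lk) // oddX subn_eq0 leqNgt lk.
- by rewrite divn_small // ltn_exp2l.
Qed.

Lemma ex_bit m j : (j < 2 ^ m)%N -> j != 0%N -> exists k : 'I_m, bit j k.
Proof.
move=> jm j0; apply/existsP; apply: contraR j0; rewrite negb_exists => /forallP h.
apply/eqP; apply: (bits_inj jm); first by rewrite expn_gt0.
by move=> k km; rewrite bit0n; have := h (Ordinal km) => /= /negbTE.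
Qed.

Lemma ex_bit_neq m j (k : 'I_m) : (j < 2 ^ m)%N -> j != 0%N -> j != (2 ^ k)%N ->
  exists2 l : 'I_m, l != k & bit j l.
Proof.
move=> jm j0 jk.
case: (boolP [exists l : 'I_m, (l != k) && bit j l]) => [/existsP[l /andP[]]|]; first by exists l.
rewrite negb_exists => /forallP h; case/eqP: jk; apply: (bits_inj jm).
  by rewrite ltn_exp2l.
move=> l lm; rewrite bit_exp2; have := h (Ordinal lm); rewrite negb_and negbK.
rewrite -(inj_eq val_inj) /=; case: eqP => [-> _|_ /= /negbTE //].
(* If no bit other than [k] is set, the bit that [j != 0] provides must be [k] itself. *)
have [l' bl'] := ex_bit jm j0; have := h l'; rewrite bl' andbT negbK => /eqP <-.
exact: bl'.
Qed.

Context {R : realType}.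

(** Distributivity, with indices identified with bit vectors: the map to bits is injective between
    sets of equal cardinality. This expresses the independence of the bits. *)
Lemma sum_prod_bit m (F : 'I_m -> bool -> R) :
  \sum_(i < 2 ^ m) \prod_(k < m) F k (bit i k) = \prod_(k < m) (F k true + F k false).
Proof.
pose code (i : 'I_(2 ^ m)) : {ffun 'I_m -> bool} := [ffun k : 'I_m => bit i k].
have code_inj : injective code.
  move=> i j /ffunP e; apply: val_inj; apply: (bits_inj (ltn_ord i) (ltn_ord j)).
  by move=> k km; have := e (Ordinal km); rewrite !ffunE.
have code_bij : bijective code.
  by apply: inj_card_bij => //; rewrite card_ffun card_bool !card_ord.
under [RHS]eq_bigr do rewrite -big_bool.
rewrite bigA_distr_bigA (reindex code) /=; last exact: onW_bij.
by apply: eq_bigr => i _; apply: eq_bigr => k _; rewrite ffunE.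
Qed.

End Bits.

(** * Bessel's identity and the variance of conditional means *)

Section Algebra.
Context {R : realType} {m : nat}.
Notation M := (2 ^ m)%N.
Variable pC0 : 'I_m -> R.
Hypothesis hp : forall k, 0 < pC0 k < 1.
Notation Ps := (Psym pC0).
Implicit Types (X : 'I_M -> R).

Lemma PC_gt0 k u : 0 < PC pC0 k u.
Proof. by have /andP[p0 p1] := hp k; case: u; rewrite /PC //; lra. Qed.

Lemma PC_sum k : PC pC0 k true + PC pC0 k false = 1.
Proof. by rewrite /PC; ring. Qed.

Lemma Psym_gt0 i : 0 < Ps i.
Proof. by apply: prodr_gt0 => k _; exact: PC_gt0. Qed.

Lemma Psym_sum_prod (g : 'I_m -> bool -> R) :
  \sum_i Ps i * \prod_(k < m) g k (bit i k) =
  \prod_(k < m) (PC pC0 k true * g k true + PC pC0 k false * g k false).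
Proof.
rewrite -(sum_prod_bit (fun k b => PC pC0 k b * g k b)).
by apply: eq_bigr => i _; rewrite big_split.
Qed.

Lemma Psym_sum1 : \sum_i Ps i = 1.
Proof.
have := Psym_sum_prod (fun _ _ => 1).
under eq_bigr do rewrite big1 // mulr1.
by move=> ->; rewrite big1 // => k _; rewrite !mulr1 PC_sum.
Qed.

(** Presents a function of one bit as a product over all bits, the shape that [Psym_sum_prod]
    evaluates. *)
Let pick (k : 'I_m) (f : bool -> R) := fun (j : 'I_m) b => if j == k then f b else 1.

Let prod_pick (k : 'I_m) f (i : 'I_M) : \prod_(j < m) pick k f j (bit i j) = f (bit i k).
Proof.
by rewrite (bigD1 k) //= /pick eqxx big1 ?mulr1 // => j /negbTE ->.
Qed.

Lemma Psym_sum_bit (k : 'I_m) (f : bool -> R) :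
  \sum_i Ps i * f (bit i k) = PC pC0 k true * f true + PC pC0 k false * f false.
Proof.
under eq_bigr do rewrite -(prod_pick k f).
rewrite Psym_sum_prod (bigD1 k) //= /pick eqxx big1 ?mulr1 // => j /negbTE ->.
by rewrite !mulr1 PC_sum.
Qed.

Lemma Psym_sum_bit2 (k l : 'I_m) (f g : bool -> R) : k != l ->
  \sum_i Ps i * (f (bit i k) * g (bit i l)) =
  (PC pC0 k true * f true + PC pC0 k false * f false) *
  (PC pC0 l true * g true + PC pC0 l false * g false).
Proof.
move=> kl; under eq_bigr do rewrite -(prod_pick k f) -(prod_pick l g) -big_split.
rewrite (Psym_sum_prod (fun j b => pick k f j b * pick l g j b)).
rewrite (bigD1 k) //= (bigD1 l) //=; last by rewrite eq_sym.
rewrite /pick !eqxx (negbTE kl) eq_sym (negbTE kl) !mul1r !mulr1 big1 ?mulr1 // => j.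
by move=> /andP[/negbTE -> /negbTE ->]; rewrite !mulr1 PC_sum.
Qed.

(** The mean of the bit is [PC pC0 k true], so this is the centred bit; [vbit] is its variance. *)
Definition cbit (k : 'I_m) (i : 'I_M) : R := (bit i k)%:R - PC pC0 k true.
Definition vbit k : R := PC pC0 k true * PC pC0 k false.

Lemma vbit_gt0 k : 0 < vbit k.
Proof. by rewrite mulr_gt0 ?PC_gt0. Qed.

Lemma cbit_mean k : \sum_i Ps i * cbit k i = 0.
Proof.
rewrite (Psym_sum_bit k (fun b => b%:R - PC pC0 k true)).
rewrite /PC /=; ring.
Qed.

Lemma cbit_cov k l : \sum_i Ps i * (cbit k i * cbit l i) = if l == k then vbit k else 0.
Proof.
case: eqP => [->|/eqP]; last first.
  rewrite eq_sym => kl.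
  rewrite (Psym_sum_bit2 (fun b => b%:R - PC pC0 k true) (fun b => b%:R - PC pC0 l true)) //.
  rewrite /PC /=; ring.
rewrite (Psym_sum_bit k (fun b => (b%:R - PC pC0 k true) * (b%:R - PC pC0 k true))).
rewrite /vbit /PC /=; ring.
Qed.

Definition mu X : R := \sum_i Ps i * X i.
Definition cf X k : R := (\sum_i Ps i * (X i * cbit k i)) / vbit k.
(** The orthogonal projection of [X], for the weights [Psym], onto the affine functions of the bits;
    [cf] is the regression coefficient on the centred bit. *)
Definition affpart X i : R := mu X + \sum_k cf X k * cbit k i.

Let sum_affpart X (Y : 'I_M -> R) : \sum_i Ps i * (Y i * affpart X i) =
  mu Y * mu X + \sum_k cf X k * \sum_i Ps i * (Y i * cbit k i).
Proof.
rewrite /affpart; under eq_bigr do rewrite !mulrDr mulrA.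
rewrite big_split /= -mulr_suml; congr (_ + _).
under eq_bigr do rewrite !mulr_sumr.
rewrite exchange_big; apply: eq_bigr => k _ /=; rewrite mulr_sumr.
by apply: eq_bigr => i _; ring.
Qed.

Let mu1 : mu (fun=> 1) = 1.
Proof. by rewrite /mu; under eq_bigr do rewrite mulr1; exact: Psym_sum1. Qed.

Let affpart_mean X : mu (affpart X) = mu X.
Proof.
have := sum_affpart X (fun=> 1); under eq_bigr do rewrite mul1r.
rewrite -/(mu (affpart X)) => ->; rewrite mu1 mul1r big1 ?addr0 // => k _.
by under eq_bigr do rewrite mul1r; rewrite cbit_mean mulr0.
Qed.

Let affpart_cov X k : \sum_i Ps i * (affpart X i * cbit k i) = cf X k * vbit k.
Proof.
under eq_bigr do rewrite [_ * cbit k _]mulrC.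
rewrite sum_affpart /mu cbit_mean mul0r add0r (bigD1 k) //= cbit_cov eqxx big1 ?addr0 //.
by move=> l /negbTE lk; rewrite cbit_cov lk mulr0.
Qed.

(** Pythagoras: the inner product of [X] with its projection equals the squared norm of the
    projection. *)
Lemma bessel X : \sum_i Ps i * X i ^+ 2 =
  mu X ^+ 2 + \sum_k cf X k ^+ 2 * vbit k + \sum_i Ps i * (X i - affpart X i) ^+ 2.
Proof.
have vc k : \sum_i Ps i * (X i * cbit k i) = cf X k * vbit k.
  by rewrite /cf divfK // gt_eqF ?vbit_gt0.
have eXZ : \sum_i Ps i * (X i * affpart X i) = mu X ^+ 2 + \sum_k cf X k ^+ 2 * vbit k.
  rewrite sum_affpart -expr2; congr (_ + _); apply: eq_bigr => k _.
  by rewrite vc mulrA.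
have eZZ : \sum_i Ps i * (affpart X i * affpart X i) = mu X ^+ 2 + \sum_k cf X k ^+ 2 * vbit k.
  rewrite sum_affpart affpart_mean -expr2; congr (_ + _); apply: eq_bigr => k _.
  by rewrite affpart_cov mulrA.
have h i : Ps i * (X i - affpart X i) ^+ 2 = Ps i * X i ^+ 2 -
   2 * (Ps i * (X i * affpart X i)) + Ps i * (affpart X i * affpart X i) by ring.
under [X in _ = _ + X]eq_bigr do rewrite h.
rewrite big_split sumrB -mulr_sumr eXZ eZZ /=; ring.
Qed.

(* Conditional law of the symbol given [C_k = u]. *)
Definition cw (k : 'I_m) (u : bool) (i : 'I_M) : R :=
  if bit i k == u then Ps i / PC pC0 k u else 0.

Lemma cw_ge0 k u i : 0 <= cw k u i.
Proof. by rewrite /cw; case: ifP => // _; rewrite divr_ge0 // ltW ?Psym_gt0 ?PC_gt0. Qed.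

Lemma cw_le k u i : cw k u i <= (PC pC0 k u)^-1 * Ps i.
Proof.
rewrite /cw; case: ifP => _; first by rewrite mulrC.
by rewrite mulr_ge0 ?invr_ge0 // ltW ?Psym_gt0 ?PC_gt0.
Qed.

Lemma cw_sum1 k u : \sum_i cw k u i = 1.
Proof.
have := Psym_sum_bit k (fun b => (b == u)%:R / PC pC0 k u).
rewrite (eq_bigr (cw k u)); last first.
  by move=> i _; rewrite /cw; case: (_ == u); rewrite ?mul1r // mul0r mulr0.
move=> ->; have := PC_gt0 k u; case: u => /= p0; field; by rewrite gt_eqF.
Qed.

Lemma cw_total k i : PC pC0 k true * cw k true i + PC pC0 k false * cw k false i = Ps i.
Proof.
have h0 := PC_gt0 k false; have h1 := PC_gt0 k true.
by rewrite /cw; case: (bit i k) => /=; field; rewrite gt_eqF.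
Qed.

(** The left side is the variance of [E (X | C_k)], which takes two values [A] and [B]. It equals
    [(A - B)^2] times the variance of the bit, and [cf X k = A - B]. *)
Lemma cond_mean_var X k :
  PC pC0 k true * (\sum_i cw k true i * X i) ^+ 2 +
  PC pC0 k false * (\sum_i cw k false i * X i) ^+ 2 - mu X ^+ 2 = cf X k ^+ 2 * vbit k.
Proof.
set A := \sum_i cw k true i * X i; set B := \sum_i cw k false i * X i.
have p1 := PC_gt0 k true; have p0 := PC_gt0 k false; have p01 := PC_sum k.
have muE : mu X = PC pC0 k true * A + PC pC0 k false * B.
  rewrite /A /B !mulr_sumr -big_split; apply: eq_bigr => i _ /=.
  by rewrite -(cw_total k i) /PC /=; ring.
have cE : cf X k * vbit k = PC pC0 k true * A - PC pC0 k true * mu X.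
  rewrite /cf divfK ?gt_eqF ?vbit_gt0 // /A /mu !mulr_sumr -sumrB.
  apply: eq_bigr => i _; rewrite /cbit /cw.
  by case: (bit i k) => /=; field; rewrite ?gt_eqF.
have cE' : cf X k = A - B.
  apply: (@mulIf _ (vbit k)); first by rewrite gt_eqF ?vbit_gt0.
  rewrite cE muE /vbit; have -> : PC pC0 k true = 1 - PC pC0 k false by lra.
  ring.
rewrite cE' muE /vbit; have -> : PC pC0 k true = 1 - PC pC0 k false by lra.
ring.
Qed.

Definition affine X := exists (al : R) (be : 'I_m -> R),
  forall i, X i = al + \sum_k be k * (bit i k)%:R.

Lemma affine_affpart X : affine X <-> (forall i, X i = affpart X i).
Proof.
split=> [[al [be h]] i|h]; last first.
  exists (mu X - \sum_k cf X k * PC pC0 k true), (cf X) => i.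
  rewrite {1}h /affpart /cbit; under eq_bigr do rewrite mulrBr.
  by rewrite sumrB; ring.
(* Centring the bits changes only the constant; orthogonality then identifies [al'] with the mean
   and [be] with [cf]. *)
have [al' h'] : exists al', forall j, X j = al' + \sum_k be k * cbit k j.
  exists (al + \sum_k be k * PC pC0 k true) => j.
  rewrite h -addrA; congr (_ + _); rewrite -big_split; apply: eq_bigr => k _.
  by rewrite /cbit /=; ring.
have E (Y : 'I_M -> R) : \sum_i Ps i * (Y i * X i) =
    al' * mu Y + \sum_k be k * \sum_i Ps i * (Y i * cbit k i).
  under eq_bigr do rewrite h' !mulrDr mulrA.
  rewrite big_split /= -mulr_suml mulrC; congr (_ + _).
  under eq_bigr do rewrite !mulr_sumr.
  rewrite exchange_big; apply: eq_bigr => k _ /=; rewrite mulr_sumr.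
  by apply: eq_bigr => j _; ring.
have muE : mu X = al'.
  have := E (fun=> 1); under eq_bigr do rewrite mul1r.
  rewrite -/(mu X) => ->; rewrite mu1 mulr1 big1 ?addr0 // => k _.
  by under eq_bigr do rewrite mul1r; rewrite cbit_mean mulr0.
have cE k : cf X k = be k.
  rewrite /cf; under eq_bigr do rewrite [_ * cbit k _]mulrC.
  rewrite E {1}/mu cbit_mean mulr0 add0r (bigD1 k) //= cbit_cov eqxx big1 ?addr0.
    by rewrite mulfK // gt_eqF ?vbit_gt0.
  by move=> l /negbTE lk; rewrite cbit_cov lk mulr0.
by rewrite h' /affpart muE; under [in RHS]eq_bigr do rewrite cE.
Qed.

End Algebra.

(** * Affine functions of the bits and the Hadamard transform *)

Section Hadamard.
Context {R : realType} {m : nat}.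
Notation M := (2 ^ m)%N.
Notation hd := (@hada R m).
Implicit Types (X : 'I_M -> R).

(** The sum factors over the bits. A bit where [i] and [j] differ contributes [1 - 1 = 0], and if
    they agree every factor is 2. *)
Lemma hada_orth (i j : 'I_M) : \sum_(l < M) hd l i * hd l j = if i == j then M%:R else 0.
Proof.
pose s (u b : bool) : R := if b && u then -1 else 1.
have -> : \sum_(l < M) hd l i * hd l j =
    \prod_(k < m) (s (bit i k) true * s (bit j k) true + s (bit i k) false * s (bit j k) false).
  rewrite -(sum_prod_bit (fun k b => s (bit i k) b * s (bit j k) b)).
  by apply: eq_bigr => l _; rewrite -big_split.
case: eqP => [->|ij].
  rewrite (eq_bigr (fun=> 2)) ?prodr_const ?card_ord ?natrX // => k _.
  by rewrite /s; case: (bit j k) => /=; ring.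
have [k bk] : exists k : 'I_m, bit i k != bit j k.
  apply/existsP; rewrite -[X in is_true X]negbK negb_exists; apply/negP => /forallP h.
  apply: ij.
  apply: val_inj; apply: (bits_inj (ltn_ord i) (ltn_ord j)) => k km.
  by have := h (Ordinal km); rewrite negbK => /eqP.
rewrite (bigD1 k) //= /s; case: (bit i k) (bit j k) bk => [] [] //= _.
  by rewrite !mulr1 addNr mul0r.
by rewrite !mul1r addNr mul0r.
Qed.

Lemma hada_sum0 (j : 'I_M) : j != 0%N :> nat -> \sum_(i < M) hd j i = 0.
Proof.
move=> j0; have [k bk] := ex_bit (ltn_ord j) j0.
rewrite (sum_prod_bit (fun k b => if bit j k && b then -1 else 1)) (bigD1 k) //=.
by rewrite bk /= addNr mul0r.
Qed.

(** Some bit [l] other than [k] is set in [j], and its factor [-1 + 1] kills the product. *)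
Lemma hada_bit0 (j : 'I_M) (k : 'I_m) : j != 0%N :> nat -> j != (2 ^ k)%N :> nat ->
  \sum_(i < M) (bit i k)%:R * hd j i = 0.
Proof.
move=> j0 jk; have [l lk bl] := ex_bit_neq (ltn_ord j) j0 jk.
have -> : \sum_(i < M) (bit i k)%:R * hd j i =
  \sum_(i < M) \prod_(t < m) ((if t == k then (bit i t)%:R else 1) *
     (if bit j t && bit i t then -1 else 1)).
  apply: eq_bigr => i _; rewrite big_split /=; congr (_ * _).
  by rewrite (bigD1 k) //= eqxx big1 ?mulr1 // => t /negbTE ->.
rewrite (sum_prod_bit (fun t b => (if t == k then b%:R else 1) *
  (if bit j t && b then -1 else 1))) (bigD1 l) //=.
by rewrite (negbTE lk) bl /= !mul1r addNr mul0r.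
Qed.

Lemma affineD X Y : affine X -> affine Y -> affine (fun i => X i + Y i).
Proof.
move=> [a [b h]] [a' [b' h']]; exists (a + a'), (fun k => b k + b' k) => i.
rewrite h h'; under [in RHS]eq_bigr do rewrite mulrDl.
by rewrite big_split /=; ring.
Qed.

Lemma affine_const (c : R) : affine (fun _ : 'I_M => c).
Proof.
exists c, (fun=> 0) => i; rewrite big1 ?addr0 // => k _; exact: mul0r.
Qed.

(** An affine function is orthogonal to the other characters. Conversely, Hadamard inversion writes
    [X] as a sum of characters, and those left, of index 0 or [2 ^ k], are affine. *)
Lemma affineP X : affine X <->
  (forall j : 'I_M, j != 0%N :> nat -> (forall k : 'I_m, j != (2 ^ k)%N :> nat) ->
    M%:R^-1 * \sum_(i < M) X i * hd j i = 0).
Proof.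
split=> [[al [be h]] j j0 jk|h].
  under eq_bigr do rewrite h mulrDl.
  rewrite big_split /= -mulr_sumr hada_sum0 // mulr0 add0r.
  under eq_bigr do rewrite mulr_suml.
  rewrite exchange_big big1 ?mulr0 //= => k _.
  under eq_bigr do rewrite -mulrA.
  by rewrite -mulr_sumr hada_bit0 // mulr0.
pose c (j : 'I_M) := M%:R^-1 * \sum_(i < M) X i * hd j i.
have M0 : M%:R != 0 :> R by rewrite pnatr_eq0 -lt0n expn_gt0.
have XE : X = (fun i => \sum_(j < M) c j * hd j i).
  apply/funext => i; rewrite /c; under eq_bigr do rewrite -mulrA mulr_suml mulr_sumr.
  rewrite exchange_big (bigD1 i) //= [X in _ = _ + X]big1 ?addr0.
    under eq_bigr do rewrite -mulrA mulrCA.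
    by rewrite -!mulr_sumr hada_orth eqxx mulVf // mulr1.
  move=> l /negbTE li; under eq_bigr do rewrite -mulrA mulrCA.
  by rewrite -!mulr_sumr hada_orth li !mulr0.
rewrite XE; elim: (index_enum _) => [|j r IH].
  by under eq_fun do rewrite big_nil; exact: affine_const.
under eq_fun do rewrite big_cons; apply: affineD => //.
have [j0|j0] := eqVneq (val j) 0%N.
  exists (c j), (fun=> 0) => i; rewrite [X in _ + X]big1 ?addr0; last first.
    by move=> k _; rewrite mul0r.
  by rewrite /hada big1 ?mulr1 // => k _; rewrite j0 bit0n.
case: (boolP [exists k : 'I_m, val j == (2 ^ k)%N]) => [/existsP[k /eqP jk]|].
  (* The character of index [2 ^ k] is 1 minus twice the bit [k]. *)
  exists (c j), (fun l => if l == k then - 2 * c j else 0) => i.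
  rewrite (bigD1 k) //= eqxx big1 ?addr0; last by move=> l /negbTE ->; rewrite mul0r.
  rewrite /hada (bigD1 k) //= jk bit_exp2 eqxx big1 ?mulr1; last first.
    by move=> l lk; rewrite bit_exp2 (inj_eq val_inj) (negbTE lk).
  by case: (bit i k) => /=; ring.
rewrite negb_exists => /forallP jk; rewrite /c h //.
under eq_fun do rewrite mul0r; exact: affine_const.
Qed.

End Hadamard.

(** * First-order optimality *)

Section MutualInformation.
Context {R : realType} {m N : nat} (pC0 : 'I_m -> R).
Hypothesis hp : forall k, 0 < pC0 k < 1.
Variables (x : 'I_(2 ^ m) -> 'I_N -> R) (N0 : R).
Hypothesis N0_gt0 : 0 < N0.
Variable h : 'I_N -> R.
Let a i n := h n * x i n.

Let pYgXE i y : pYgX N0 x h i y = phi N0 y * expR (llr N0 (a i) y).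
Proof.
rewrite /pYgX; under eq_bigr do rewrite gauss_shift //.
rewrite big_split -expR_sum; congr (_ * expR _).
rewrite /llr /dotp -mulr_suml sumrB -mulr_sumr mulrBl mulrAC; congr (_ - _ / _).
Qed.

Let pYE y : pY pC0 N0 x h y = phi N0 y * mix N0 (Psym pC0) a y.
Proof.
by rewrite /pY /mix mulr_sumr; apply: eq_bigr => i _; rewrite pYgXE mulrCA.
Qed.

Let pYgCE k u y : pYgC pC0 N0 x h k u y = phi N0 y * mix N0 (cw pC0 k u) a y.
Proof.
rewrite /pYgC /mix mulr_suml mulr_sumr big_mkcond; apply: eq_bigr => i _.
by rewrite /cw pYgXE; case: ifP => _; [ring | rewrite mul0r mulr0].
Qed.

Let phi_gt0 (y : 'I_N -> R) : 0 < phi N0 y.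
Proof. by apply: prodr_gt0 => n _; exact: gauss_gt0. Qed.

Let cw0 k u := cw_ge0 hp k u.
Let cw1 k u := cw_sum1 hp k u.
Let Ps0 i : 0 <= Psym pC0 i. Proof. exact: ltW (Psym_gt0 hp i). Qed.
Let Ps1 := Psym_sum1 pC0.

(** The part of the divergence that involves the output law; its average over [u] is [mixH] for
    [Psym]. *)
Let cross k u (y : 'I_N -> R) :=
  mix N0 (cw pC0 k u) a y * ln (mix N0 (Psym pC0) a y).

Let gint_cross k u : gint N0 (cross k u).
Proof.
apply: (@gint_le _ _ _ N0_gt0 _
  (fun y => (PC pC0 k u)^-1 * (1 + mix N0 (Psym pC0) a y ^+ 2))).
- move=> d V Y mY; apply: measurable_funM; first exact: emeas_mix.
  by apply: (measurableT_comp (@measurable_ln R)); exact: emeas_mix.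
- move=> y; rewrite /cross normrM gtr0_norm; last exact: mix_gt0.
  have Pm : 0 < mix N0 (Psym pC0) a y by exact: mix_gt0.
  (* Conditioning raises the weights by at most [1 / PC pC0 k u], so the mixed term is controlled by
     [xlnx] of the full mixture. *)
  apply: (@le_trans _ _ ((PC pC0 k u)^-1 * mix N0 (Psym pC0) a y *
    `|ln (mix N0 (Psym pC0) a y)|)).
    apply: ler_wpM2r => //; rewrite mulr_sumr; apply: ler_sum => i _.
    by rewrite mulrA; apply: ler_wpM2r; [exact: expR_ge0 | exact: cw_le].
  rewrite -mulrA; apply: ler_wpM2l; first by rewrite invr_ge0 ltW // PC_gt0.
  rewrite -{1}(gtr0_norm Pm) -normrM; exact: xlnx_norm_le.
- apply: gintZ; apply: gintD; first exact: gint1.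
  exact: gint_mix_sqr.
Qed.

Let intRN_KL k u :
  intRN (fun y => pYgC pC0 N0 x h k u y *
    log2 (pYgC pC0 N0 x h k u y / pY pC0 N0 x h y)) =
  (ln 2)^-1 * (mixH N0 (cw pC0 k u) a - gexp N0 (cross k u)).
Proof.
have gH : gint N0 (fun y => xlnx (mix N0 (cw pC0 k u) a y)) by exact: gint_xlnx_mix.
have gC := gint_cross k u.
have gN : gint N0 (fun y => (-1) * cross k u y) by exact: gintZ.
rewrite -[in RHS]mulN1r -gexpZ // -gexpD // -gexpZ; last exact: gintD.
congr intRN; apply/funext => y; rewrite pYgCE pYE /log2.
have p1 : 0 < mix N0 (cw pC0 k u) a y by exact: mix_gt0.
have p2 : 0 < mix N0 (Psym pC0) a y by exact: mix_gt0.
rewrite -mulf_div divff ?gt_eqF // mul1r ln_div // /cross /xlnx.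
ring.
Qed.

(** The noise density cancels in the likelihood ratio, and by total probability the cross terms
    average to the entropy of the full mixture. *)
Lemma MIkE k : MIk pC0 N0 x h k = (ln 2)^-1 *
  (PC pC0 k true * mixH N0 (cw pC0 k true) a +
   PC pC0 k false * mixH N0 (cw pC0 k false) a - mixH N0 (Psym pC0) a).
Proof.
rewrite /MIk big_bool /= !intRN_KL.
have -> : mixH N0 (Psym pC0) a =
  PC pC0 k true * gexp N0 (cross k true) + PC pC0 k false * gexp N0 (cross k false).
  rewrite -!gexpZ // -gexpD; [|exact: gintZ|exact: gintZ].
  congr gexp; apply/funext => y; rewrite /cross /xlnx !mulrA -mulrDl; congr (_ * _).
  rewrite /mix !mulr_sumr -big_split; apply: eq_bigr => i _.
  by rewrite /= !mulrA -mulrDl (cw_total hp).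
rewrite /PC; ring.
Qed.

End MutualInformation.

Unset Implicit Arguments.

Theorem theorem9 (R : realType) (m N : nat) (hm : (0 < m)%N) (hN : (0 < N)%N)
  (x : 'I_(2 ^ m) -> 'I_N -> R) (pC0 : 'I_m -> R)
  (hp : forall k, 0 < pC0 k < 1)
  (hEs : 0 < Es pC0 x)
  (d : measure_display) (T : measurableType d) (P : probability T R)
  (H : 'I_N -> T -> R) (pH : R -> R)
  (hpH_meas : measurable_fun setT pH) (hpH_ge0 : forall t, 0 <= pH t)
  (hH_meas : forall n, measurable_fun setT (H n))
  (hH_law : forall n (A : set R), measurable A ->
     P (H n @^-1` A) = (\int[lebesgue_measure]_(t in A) (pH t)%:E)%E)
  (hH2 : lebesgue_measure.-integrable setT (fun t => (t ^+ 2 * pH t)%:E))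
  (hEH2 : 0 < EH2 pH) :
  FOO P H pH pC0 x <->
  (mean pC0 x = (fun _ => 0) /\
   forall j : 'I_(2 ^ m), (j != 0%N :> nat) -> (forall k : 'I_m, (j != (2 ^ k)%N :> nat)) ->
     hadamard x j = (fun _ => 0)).
Proof.
have H_sqr n := integrable_sqr_density (hH_meas n) hpH_meas (hH_law n) hH2.
(* At SNR [s] the noise level is [N0 = c / s]. *)
pose c := EH2 pH * Es pC0 x; have c0 : 0 < c by rewrite mulr_gt0.
pose X n i := x i n.
(* By [cond_mean_var], this is the variance of [E (X | C_k)] summed over bits and coordinates. *)
pose S := \sum_n \sum_k cf pC0 (X n) k ^+ 2 * vbit pC0 k.
have ln2 : 0 < ln 2 :> R by rewrite ln_gt0 // ltr1n.
have GMI_cvg : (fun s => GMI P H pH pC0 x s / s) @ 0^'+ --> (ln 2)^-1 * (S / Es pC0 x).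
  pose J (v : 'I_(2 ^ m) -> R) s :=
    Rintegral P setT (fun w => mixH (c / s) v (fun i n => H n w * x i n)) / s.
  pose L (v : 'I_(2 ^ m) -> R) := c^-1 * (EH2 pH * \sum_n (\sum_i v i * x i n) ^+ 2).
  have JL v : (forall i, 0 <= v i) -> \sum_i v i = 1 -> J v s @[s --> 0^'+] --> L v.
    by move=> v0 v1; apply: expect_mixH_slope.
  have -> : (ln 2)^-1 * (S / Es pC0 x) = \sum_k (ln 2)^-1 *
    (PC pC0 k true * L (cw pC0 k true) + PC pC0 k false * L (cw pC0 k false) - L (Psym pC0)).
    rewrite -mulr_sumr; congr (_ * _).
    rewrite /S exchange_big mulr_suml; apply: eq_bigr => k _ /=.
    rewrite /L /c.
    under eq_bigr do rewrite -cond_mean_var //.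
    rewrite sumrB big_split /= -!mulr_sumr /mu /X; field.
    by rewrite !gt_eqF.
  apply: (@cvg_trans _ ((fun s => \sum_k (ln 2)^-1 * (PC pC0 k true * J (cw pC0 k true) s +
     PC pC0 k false * J (cw pC0 k false) s - J (Psym pC0) s)) @ 0^'+)).
    (* The formula of [MIkE] requires [N0 > 0], so the functions are compared only for [s > 0]. *)
    apply: near_eq_cvg; near=> s; have s0 : 0 < s by near: s; exact: near_right0_gt0.
    have cs : 0 < c / s by rewrite divr_gt0.
    rewrite /GMI -/c mulr_suml; apply: eq_bigr => k _.
    pose K v w := mixH (c / s) v (fun i n => H n w * x i n).
    have iK v : (forall i, 0 <= v i) -> \sum_i v i = 1 ->
        P.-integrable setT (EFin \o K v).
      by move=> v0 v1; exact: (integrable_mixH hH_meas H_sqr).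
    have i1 := iK _ (cw_ge0 hp k true) (cw_sum1 hp k true).
    have i0 := iK _ (cw_ge0 hp k false) (cw_sum1 hp k false).
    have ip := iK _ (fun i => ltW (Psym_gt0 hp i)) (Psym_sum1 pC0).
    have iZ r f : P.-integrable setT (EFin \o f) ->
        P.-integrable setT (EFin \o (fun w : T => r * f w)).
      move=> h; rewrite (_ : _ \o _ = (fun w => r%:E * (f w)%:E)%E) //.
      exact: integrableZl.
    have iD f g : P.-integrable setT (EFin \o f) -> P.-integrable setT (EFin \o g) ->
        P.-integrable setT (EFin \o (fun w : T => f w + g w)).
      move=> h h'; rewrite (_ : _ \o _ = (fun w => (f w)%:E + (g w)%:E)%E) //.
      exact: integrableD.
    have iB f g : P.-integrable setT (EFin \o f) -> P.-integrable setT (EFin \o g) ->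
        P.-integrable setT (EFin \o (fun w : T => f w - g w)).
      move=> h h'; rewrite (_ : _ \o _ = (fun w => (f w)%:E - (g w)%:E)%E) //.
      exact: integrableB.
    have -> : Rintegral P setT (fun w => MIk pC0 (c / s) x (fun n => H n w) k) =
      Rintegral P setT (fun w => (ln 2)^-1 * (PC pC0 k true * K (cw pC0 k true) w +
        PC pC0 k false * K (cw pC0 k false) w - K (Psym pC0) w)).
      by apply: eq_Rintegral => w _; rewrite MIkE.
    rewrite RintegralZl //; last by apply: iB => //; apply: iD; exact: iZ.
    rewrite RintegralB //; last by apply: iD; exact: iZ.
    rewrite RintegralD //; [|exact: iZ|exact: iZ].
    by rewrite !RintegralZl // /J; ring.
  apply: cvg_right_sum => k; apply: cvgM; first exact: cvg_cst.
  apply: cvgB; first apply: cvgD.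
  - by apply: cvgM; [exact: cvg_cst | apply: JL; [exact: cw_ge0 | exact: cw_sum1]].
  - by apply: cvgM; [exact: cvg_cst | apply: JL; [exact: cw_ge0 | exact: cw_sum1]].
  - by apply: JL; [move=> i; rewrite ltW ?Psym_gt0 | exact: Psym_sum1].
have FOO_S : FOO P H pH pC0 x <-> S = Es pC0 x.
  have log2e : log2 (expR 1) = (ln 2)^-1 :> R by rewrite /log2 expRK mul1r.
  rewrite /FOO log2e; split=> [F|SE]; last first.
    by move: GMI_cvg; rewrite SE divff ?gt_eqF // mulr1.
  have E : (ln 2)^-1 = (ln 2)^-1 * (S / Es pC0 x) by exact: cvg_unique F GMI_cvg.
  have l0 : (ln 2)^-1 != 0 :> R by rewrite invr_eq0 gt_eqF.
  have e : 1 = S / Es pC0 x by apply: (mulfI l0); rewrite mulr1.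
  have Es0 : Es pC0 x != 0 by rewrite gt_eqF.
  by rewrite -[LHS](divfK Es0) -e mul1r.
(* Bessel's identity in each coordinate: [Es] exceeds [S] by nonnegative terms, so equality forces
   every mean and every residual to vanish. *)
have EsE : Es pC0 x = S + \sum_n (mu pC0 (X n) ^+ 2 +
    \sum_i Psym pC0 i * (X n i - affpart pC0 (X n) i) ^+ 2).
  rewrite /Es; under eq_bigr do rewrite mulr_sumr.
  rewrite exchange_big /S -big_split; apply: eq_bigr => n _ /=.
  by rewrite (bessel hp (X n)); ring.
have res_ge0 n : 0 <= \sum_i Psym pC0 i * (X n i - affpart pC0 (X n) i) ^+ 2.
  by apply: sumr_ge0 => i _; rewrite mulr_ge0 ?sqr_ge0 // ltW ?Psym_gt0.
rewrite FOO_S EsE; split.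
- move=> e.
  have /psumr_eq0P z : \sum_n (mu pC0 (X n) ^+ 2 +
    \sum_i Psym pC0 i * (X n i - affpart pC0 (X n) i) ^+ 2) = 0 by lra.
  have {}z n : mu pC0 (X n) = 0 /\ forall i, X n i = affpart pC0 (X n) i.
    have /eqP := z (fun n _ => addr_ge0 (sqr_ge0 _) (res_ge0 n)) n isT.
    rewrite paddr_eq0 ?sqr_ge0 // sqrf_eq0 => /andP[/eqP -> /eqP /psumr_eq0P r0].
    split=> // i; apply/eqP; rewrite -subr_eq0 -sqrf_eq0.
    have /eqP := r0 (fun i _ => mulr_ge0 (ltW (Psym_gt0 hp i)) (sqr_ge0 _)) i isT.
    by rewrite mulf_eq0 gt_eqF ?Psym_gt0.
  split; first by apply/funext => n; have [] := z n.
  move=> j j0 jk; apply/funext => n.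
  by have [_ /(affine_affpart hp) /affineP] := z n; apply.
- move=> [mu0 had]; rewrite big1 ?addr0 // => n _.
  have -> : mu pC0 (X n) = 0 by have := congr1 (fun f => f n) mu0.
  rewrite expr0n add0r big1 // => i _.
  have /(affine_affpart hp) <- : affine (X n).
    apply/affineP => j j0 jk.
    by have := congr1 (fun f => f n) (had j j0 jk).
  by rewrite subrr expr0n mulr0.
Unshelve. all: by end_near. Qed.
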